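(* Let $f\in\mathbb{C}[z_1,\dots,z_n]$ be a nonzero homogeneous polynomial. Then: (1) $\mathcal V_{\mathbb R}(f)\subseteq\mathcal I(f)$, with equality if and only if there is $\phi\in[0,2\pi)$ such that $e^{i\phi}f$ is a product of linear polynomials with real coefficients. (2) If $f$ is hyperbolic (in some direction) and irreducible, then the Zariski closure in $\mathbb{C}^n$ of the boundary $\partial\big(\mathbb{R}^n\setminus\mathcal I(f)\big)$ equals $\mathcal V(f)$.
   Context: For $f\in\mathbb{C}[z_1,\dots,z_n]$, $\mathcal{V}(f)\subseteq\mathbb{C}^n$ denotes its complex zero set, $\mathcal V_{\mathbb R}(f)=\mathcal V(f)\cap\mathbb{R}^n$ its real zero set, and the imaginary projection of $f$ is $\mathcal{I}(f)=\{\Im(\mathbf z):\mathbf z\in\mathcal V(f)\}\subseteq\mathbb{R}^n$, where $\Im$ is taken componentwise. A homogeneous polynomial $f$ is hyperbolic in direction $\mathbf e\in\mathbb{R}^n$ if $f(\mathbf e)\neq 0$ and for every $\mathbf x\in\mathbb{R}^n$ the univariate polynomial $t\mapsto f(\mathbf x+t\mathbf e)$ has only real roots. *)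

(* Defs.v *)
(* Complex numbers are modelled by an arbitrary
   numClosedFieldType C. *)
From HB Require Import structures.
From mathcomp Require Import all_boot all_order all_algebra.
Set Implicit Arguments. Unset Strict Implicit. Unset Printing Implicit Defensive.
Import Order.TTheory GRing.Theory Num.Theory.
Local Open Scope ring_scope.

(* Multivariate polynomials in n variables over C, represented by a finite
   list of terms (coefficient, exponent vector); the polynomial is the sum. *)
Definition expo (n : nat) := (n.-tuple nat)%type.
Definition mpoly (C : Type) (n : nat) := seq (C * expo n).

Section MPoly.
Variables (C : numClosedFieldType) (n : nat).

Definition expo0 : expo n := [tuple 0%N | i < n].
Definition expoD (a b : expo n) : expo n := [tuple (tnth a i + tnth b i)%N | i < n].
Definition expoU (i : 'I_n) : expo n := [tuple (i == j : nat) | j < n].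
Definition tdeg (m : expo n) : nat := (\sum_(i < n) tnth m i)%N.

Definition mcoeff (p : mpoly C n) (m : expo n) : C :=
  \sum_(t <- p | t.2 == m) t.1.

Definition mpeq (p q : mpoly C n) : Prop := forall m, mcoeff p m = mcoeff q m.

Definition mp_nonzero (p : mpoly C n) : Prop := exists m, mcoeff p m != 0.

Definition mp_homogeneous (p : mpoly C n) : Prop :=
  exists d, forall m, mcoeff p m != 0 -> tdeg m = d.

Definition mp_constant (p : mpoly C n) : Prop :=
  forall m, mcoeff p m != 0 -> tdeg m = 0%N.

Definition mpmul (p q : mpoly C n) : mpoly C n :=
  [seq (a.1 * b.1, expoD a.2 b.2) | a <- p, b <- q].

Definition mpscale (c : C) (p : mpoly C n) : mpoly C n :=
  [seq (c * a.1, a.2) | a <- p].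

Definition mp1 : mpoly C n := [:: (1, expo0)].

Definition mpprod (s : seq (mpoly C n)) : mpoly C n := foldr mpmul mp1 s.

(* irreducible in C[z_1..z_n]: non-constant and not a product of two
   non-constant polynomials (units of C[z] are the nonzero constants) *)
Definition mp_irreducible (p : mpoly C n) : Prop :=
  ~ mp_constant p /\
  forall q r, mpeq p (mpmul q r) -> mp_constant q \/ mp_constant r.

Definition meval (p : mpoly C n) (z : 'I_n -> C) : C :=
  \sum_(t <- p) t.1 * \prod_(i < n) z i ^+ tnth t.2 i.

Definition linpoly (a0 : C) (a : 'I_n -> C) : mpoly C n :=
  (a0, expo0) :: [seq (a i, expoU i) | i <- enum 'I_n].

Definition real_linear (l : mpoly C n) : Prop :=
  exists a0 (a : 'I_n -> C), a0 \is Num.real /\ (forall i, a i \is Num.real)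
                             /\ l = linpoly a0 a.

(* points of R^n are points of C^n with real coordinates *)
Definition realvec (x : 'I_n -> C) : Prop := forall i, x i \is Num.real.

Definition zero_set (f : mpoly C n) (z : 'I_n -> C) : Prop := meval f z = 0.

Definition real_zero_set (f : mpoly C n) (x : 'I_n -> C) : Prop :=
  realvec x /\ meval f x = 0.

Definition imag_proj (f : mpoly C n) (y : 'I_n -> C) : Prop :=
  realvec y /\ exists z, meval f z = 0 /\ forall i, y i = 'Im (z i).

Definition hyperbolic_in (f : mpoly C n) (e : 'I_n -> C) : Prop :=
  realvec e /\ meval f e != 0 /\
  forall x, realvec x -> forall t : C,
    meval f (fun i => x i + t * e i) = 0 -> t \is Num.real.

Definition hyperbolic (f : mpoly C n) : Prop :=
  mp_homogeneous f /\ exists e, hyperbolic_in f e.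

Definition rclosure (S : ('I_n -> C) -> Prop) (x : 'I_n -> C) : Prop :=
  realvec x /\ forall eps : C, 0 < eps ->
    exists y, S y /\ forall i, `|x i - y i| < eps.

Definition rcompl (S : ('I_n -> C) -> Prop) (y : 'I_n -> C) : Prop :=
  realvec y /\ ~ S y.

Definition rboundary (S : ('I_n -> C) -> Prop) (x : 'I_n -> C) : Prop :=
  rclosure S x /\ rclosure (rcompl S) x.

Definition zariski_closure (S : ('I_n -> C) -> Prop) (z : 'I_n -> C) : Prop :=
  forall g : mpoly C n, (forall w, S w -> meval g w = 0) -> meval g z = 0.

End MPoly.

(* Main.v *)
(** Part 1. If [V_R(f) = I(f)] and [z] is a zero of [f], then by homogeneity [f] vanishes
    at the imaginary parts of all complex multiples of [z], hence on the plane spanned by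
    [Re z] and [Im z].  Let [P] be a prime factor of [f], nonconstant in the first variable
    after a shear.  At a generic real [y] each root [r] of [P(., y)] is simple and the gradient of
    [P] at [(r, y)] annihilates [Re z] for every zero [z] of [P] lying over a point [x + iy]
    with ['Im z_0 = r].  So ['Re z_0] is one of finitely many linear functions of [x], and [P]
    has a linear factor; it is real because [f] does not vanish on the first axis.

    Part 2. The complement of [I(f)] is the set of [y] such that [f(x + iy) <> 0] for all
    real [x].  A Garding-type argument shows that it contains every [v] that is joined to one of
    its points by a segment avoiding [V(f)]: map the upper half-plane to the unit disc and
    deform the resulting univariate polynomial, which keeps no root on the unit circle.  In
    place of a continuity-of-roots argument over the reals, the Schur-Cohn recursion shows
    that being zero-free on the disc changes at finitely many parameters only, and local
    estimates exclude a change at those (the field need not be Archimedean or complete).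
    Hence the boundary lies in [V(f)].  Conversely it meets every real line parallel to a
    hyperbolicity direction; a polynomial [g] vanishing on it and not divisible by the prime
    [f] would yield, by elimination, a nonzero polynomial in the remaining variables that
    vanishes at every real point. *)
Require Import Defs.
From HB Require Import structures.
From Stdlib Require Import Classical.
From mathcomp Require Import all_boot all_order all_algebra.
From mathcomp Require Import ring.
Import Order.TTheory GRing.Theory Num.Theory.
Local Open Scope ring_scope.
Set Implicit Arguments. Unset Strict Implicit. Unset Printing Implicit Defensive.

(** * Unique factorization and elimination *)

Section Divisibility.
Variable R : idomainType.
Implicit Types a b p q : R.

Definition divides a b := exists c, b = c * a.

Definition prime_elt p :=
  [/\ p != 0, p \isn't a GRing.unit
    & forall a b, divides p (a * b) -> divides p a \/ divides p b].

(** Factors are prime, not merely irreducible, so uniqueness comes for free and [ufd] only has to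
    ask for existence. *)
Inductive factored : R -> Prop :=
| factored_unit u : u \is a GRing.unit -> factored u
| factored_mulp p a : prime_elt p -> factored a -> factored (p * a).

Definition ufd := forall a, a != 0 -> factored a.

Lemma divides_mull a b c : divides a b -> divides a (c * b).
Proof. by case=> d ->; exists (c * d); rewrite mulrA. Qed.

Lemma divides_mulr a b c : divides a b -> divides a (b * c).
Proof. by rewrite mulrC; apply: divides_mull. Qed.

Lemma dividesD a b c : divides a b -> divides a c -> divides a (b + c).
Proof. by case=> d -> [e ->]; exists (d + e); rewrite mulrDl. Qed.

Lemma dividesB a b c : divides a b -> divides a c -> divides a (b - c).
Proof. by case=> d -> [e ->]; exists (d - e); rewrite mulrBl. Qed.

Lemma divides_trans a b c : divides a b -> divides b c -> divides a c.
Proof. by case=> d -> [e ->]; exists (e * d); rewrite mulrA. Qed.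

Lemma factored_mul a b : factored a -> factored b -> factored (a * b).
Proof.
move=> fa fb; elim: fa => {a} [u uu|p a pp _ IH].
  case: fb => {b} [v uv|p b pp fb]; first by apply: factored_unit; rewrite unitrM uu.
  rewrite mulrCA; apply: factored_mulp pp _.
  elim: fb => {b} [v uv|q b pq fb IH]; first by apply: factored_unit; rewrite unitrM uu.
  by rewrite mulrCA; apply: factored_mulp.
by rewrite -mulrA; apply: factored_mulp.
Qed.

Lemma prime_dvd_unit p u : prime_elt p -> u \is a GRing.unit -> ~ divides p u.
Proof. by case=> _ np _ uu [c uE]; move: uu; rewrite uE unitrM (negPf np) andbF. Qed.

Lemma prime_dvd_prime p q : prime_elt p -> prime_elt q -> divides p q -> divides q p.
Proof.
move=> [p0 pu _] [q0 qu qP] [c qE].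
have: divides q (c * p) by exists 1; rewrite mul1r qE.
case/qP=> // -[d cE]; case/negP: pu; apply/unitrPr; exists d.
by apply: (mulfI q0); rewrite mulr1 {2}qE cE; ring.
Qed.

(** A factorization of an irreducible [f] begins with a prime whose cofactor must be a unit, so [f]
    is an associate of that prime. *)
Lemma factored_irreducible_prime f :
  factored f -> f \isn't a GRing.unit ->
  (forall a b, f = a * b -> a \is a GRing.unit \/ b \is a GRing.unit) -> prime_elt f.
Proof.
case=> {f} [u ->//|p a [p0 pu pP] _ _ /(_ _ _ erefl)] [|ua]; first by rewrite (negPf pu).
have a0 : a != 0 by apply: contraTneq ua => ->; rewrite unitr0.
split; rewrite ?mulf_neq0 ?unitrM ?(negPf pu) // => b c [d bcE].
have [] : divides p b \/ divides p c.
- by apply: pP; exists (d * a); rewrite bcE mulrA mulrAC.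
- by case=> e ->; left; exists (e / a); rewrite mulrA [e / a * p]mulrAC divrK.
- by case=> e ->; right; exists (e / a); rewrite mulrA [e / a * p]mulrAC divrK.
Qed.

End Divisibility.

Lemma min_size_witness (R : nzRingType) (K : {poly R} -> Prop) :
  (exists r, K r /\ r != 0) ->
  exists r, [/\ K r, r != 0 & forall r', K r' -> r' != 0 -> (size r <= size r')%N].
Proof.
case=> r [Kr r0]; have [m lerm] := ubnP (size r).
elim: m => // m IH in r lerm Kr r0 *.
have [[r' [Kr' [r'0 lt]]]|H] :=
  classic (exists r', K r' /\ r' != 0 /\ (size r' < size r)%N).
  by apply: (IH r') => //; apply: leq_trans lt _.
exists r; split=> // r' Kr' r'0; rewrite leqNgt; apply/negP => lt.
by apply: H; exists r'.
Qed.

(** * Gauss's lemma: polynomial rings over a factorial domain *)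

Section PolyUFD.
Variable A : idomainType.
Implicit Types (p a b c : A) (f g h r : {poly A}).

(** The gcd over the fraction field, with denominators cleared. A nonzero [r] of least size in the
    ideal of [f] and [g] divides every member up to a power of its leading coefficient, since
    pseudo-remainders stay in the ideal and are shorter. *)
Lemma ideal_gcd f g : f != 0 ->
  exists (r u v : {poly A}) (a b : A) (w w' : {poly A}), [/\ r != 0, r = u * f + v * g,
    a != 0, b != 0 & a%:P * f = w * r /\ b%:P * g = w' * r].
Proof.
move=> f0; pose K r := exists u v : {poly A}, r = u * f + v * g.
have [|r [[u [v rE]] r0 rmin]] := @min_size_witness A K.
  by exists f; split=> //; exists 1, 0; rewrite mul1r mul0r addr0.
have Kdvd h : K h -> (lead_coef r ^+ scalp h r)%:P * h = (h %/ r)%R * r.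
  move=> [x [y hE]]; rewrite mul_polyC Pdiv.Idomain.divp_eq.
  suff -> : h %% r = 0 by rewrite addr0.
  have [//|m0] := eqVneq (h %% r) 0.
  have : (size r <= size (h %% r)%R)%N.
    apply: rmin m0; set l := lead_coef r ^+ scalp h r.
    exists (l%:P * x - (h %/ r)%R * u), (l%:P * y - (h %/ r)%R * v).
    have -> : h %% r = l *: h - (h %/ r)%R * r.
      by rewrite Pdiv.Idomain.divp_eq addrC addKr.
    rewrite rE hE -mul_polyC !mulrBl !mulrDr !mulrA opprD.
    by rewrite -!addrA; congr (_ + _); rewrite addrCA.
  by rewrite leqNgt Pdiv.Idomain.ltn_modp r0.
have lr m : lead_coef r ^+ m != 0 by rewrite expf_neq0 ?lead_coef_eq0.
exists r, u, v, (lead_coef r ^+ scalp f r), (lead_coef r ^+ scalp g r), (f %/ r)%R, (g %/ r)%R.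
split=> //; split; apply: Kdvd.
  by exists 1, 0; rewrite mul1r mul0r addr0.
by exists 0, 1; rewrite mul1r mul0r add0r.
Qed.

Lemma divides_polyC p c : divides p c -> divides p%:P c%:P.
Proof. by case=> d ->; exists d%:P; rewrite polyCM. Qed.

Lemma divides_polyCP p f : divides p%:P f -> forall i, divides p f`_i.
Proof. by case=> g -> i; exists g`_i; rewrite coefMC. Qed.

Lemma polyC_divides p f : (forall i, divides p f`_i) -> divides p%:P f.
Proof.
elim/poly_ind: f => [_|f c IH H]; first by exists 0; rewrite mul0r.
apply: dividesD; last first.
  by apply: divides_polyC; have := H 0%N; rewrite coefD coefMX coefC /= add0r.
apply/divides_mulr/IH => i.
by have := H i.+1; rewrite coefD coefMX coefC /= addr0.
Qed.

Lemma divides_mulX p f : divides p%:P (f * 'X) -> divides p%:P f.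
Proof.
by move=> /divides_polyCP H; apply: polyC_divides => i; have := H i.+1; rewrite coefMX.
Qed.

Lemma prime_polyC p : prime_elt p -> prime_elt p%:P.
Proof.
case=> p0 pu pP; split; first by rewrite polyC_eq0.
  apply: contra pu => up; have := rmorph_unit (horner_eval (0 : A)) up.
  by rewrite /= /horner_eval hornerC.
elim/poly_ind=> [g _|f c IHf]; first by left; exists 0; rewrite mul0r.
elim/poly_ind=> [_|g d IHg H]; first by right; exists 0; rewrite mul0r.
have : divides p (c * d).
  have := divides_polyCP H 0; rewrite coef0M !coefD !coefMX !coefC /=.
  by rewrite !add0r.
case/pP=> [/divides_polyC pc|/divides_polyC pd].
  have : divides p%:P (f * (g * 'X + d%:P)).
    apply: divides_mulX; have := dividesB H (divides_mulr (g * 'X + d%:P) pc).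
    by congr divides; ring.
  case/IHf=> [pf|]; last by right.
  by left; apply: dividesD pc; apply: divides_mulr.
have : divides p%:P ((f * 'X + c%:P) * g).
  apply: divides_mulX; have := dividesB H (divides_mull (f * 'X + c%:P) pd).
  by congr divides; ring.
case/IHg=> [|pg]; first by left.
by right; apply: dividesD pd; apply: divides_mulr.
Qed.

Definition primitive f := forall p, prime_elt p -> ~ divides p%:P f.

(** Each prime of [c] divides [f * m] but not the primitive [f], so it can be cancelled from [m]. *)
Lemma primitive_cancel f c h m : factored c -> primitive f ->
  c%:P * h = f * m -> divides f h.
Proof.
move=> fc prf; elim: fc m => {c} [u uu|p c pp _ IH] m E.
  exists (u^-1%:P * m); have: u^-1%:P * (u%:P * h) = u^-1%:P * (f * m) by rewrite E.
  by rewrite mulrA -polyCM mulVr // mul1r => ->; ring.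
have [p0 _ pP] := prime_polyC pp.
have [//|//|[k mE]] := pP f m _; first by exists (c%:P * h); rewrite -E polyCM; ring.
  by move=> /(prf _ pp).
apply: (IH k); apply: (mulfI p0); rewrite mulrA -polyCM E mE; ring.
Qed.

(* Irreducibility over the fraction field, stated without fractions. *)
Definition frac_irreducible f := forall a g h,
  a != 0 -> a%:P * f = g * h -> (size g <= 1)%N \/ (size h <= 1)%N.

(** Every prime of the denominator [a] stays prime as a constant polynomial, so it divides [g] or
    [h] and can be cancelled there without changing the size. *)
Lemma frac_factor f a g h : factored a -> f != 0 -> a%:P * f = g * h ->
  exists g' h', [/\ f = g' * h', size g' = size g & size h' = size h].
Proof.
move=> fa f0; elim: fa g h => {a} [u uu|p a pp _ IH] g h E.
  exists (u^-1 *: g), h; split=> //.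
    by rewrite -scalerAl -E -mul_polyC mulrA -polyCM mulVr // mul1r.
  by rewrite size_scale // invr_eq0; apply: contraTneq uu => ->; rewrite unitr0.
have [p0 _ pP] := prime_polyC pp; have p00 : p != 0 by rewrite polyC_eq0 in p0.
have [|[k gE]|[k hE]] := pP g h.
- by exists (a%:P * f); rewrite -E polyCM; ring.
- have [g' [h' [-> sg sh]]] : exists g' h', [/\ f = g' * h', size g' = size k & size h' = size h].
    by apply: IH; apply: (mulfI p0); rewrite mulrA -polyCM E gE; ring.
  by exists g', h'; split=> //; rewrite sg gE mulrC mul_polyC size_scale.
- have [g' [h' [-> sg sh]]] : exists g' h', [/\ f = g' * h', size g' = size g & size h' = size k].
    by apply: IH; apply: (mulfI p0); rewrite mulrA -polyCM E hE; ring.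
  by exists g', h'; split=> //; rewrite sh hE mulrC mul_polyC size_scale.
Qed.

Lemma size_divides_polyC f c : c != 0 -> divides f c%:P -> (size f <= 1)%N.
Proof.
move=> c0 [k kE]; have : k * f != 0 by rewrite -kE polyC_eq0.
rewrite mulf_eq0 negb_or => /andP[k0 f0].
have := size_mul k0 f0; rewrite -kE size_polyC c0; move: k0 f0.
rewrite -!size_poly_gt0; case: (size k) => // i _.
by case: (size f) => [|[|j]] // _; rewrite !addnS addSn.
Qed.

(** With [r] from [ideal_gcd], the prime [p] divides [w * r]. If it divides [w], then [r] divides a
    nonzero constant and is itself the [c] sought. If it divides [r], then it divides [b%:P * g],
    hence a nonzero constant or [g], both excluded. *)
Lemma elimination (p g : {poly A}) : prime_elt p -> (1 < size p)%N -> ~ divides p g ->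
  exists c u v, c != 0 /\ c%:P = u * p + v * g.
Proof.
move=> pp sp npg; have [p0 _ pP] := pp.
have [r [u [v [a [b [w [w' [r0 rE a0 b0 [aE bE]]]]]]]]] := ideal_gcd g p0.
have [|[k wE]|[k rpE]] := pP w r; first by exists a%:P.
  have krE : a%:P = k * r by apply: (mulIf p0); rewrite aE wE; ring.
  have : (size r <= 1)%N by apply: (size_divides_polyC a0); exists k.
  move=> /size1_polyC rC; exists r`_0, u, v; rewrite -rC; split=> //.
  by rewrite -polyC_eq0 -rC.
have [||//] := pP b%:P g; first by exists (w' * k); rewrite bE rpE mulrA.
by move=> /(size_divides_polyC b0); rewrite leqNgt sp.
Qed.

Hypothesis ufdA : ufd A.

(** If [f] divides [g * h], the gcd [r] of [f] and [g] is a constant or, over the fraction field, an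
    associate of [f]. In the first case a constant multiple of [h] is a multiple of [f], in the
    second one of [g]; primitivity removes the constant. *)
Lemma primitive_irreducible_prime f : (1 < size f)%N ->
  primitive f -> frac_irreducible f -> prime_elt f.
Proof.
move=> sf prf irf; have f0 : f != 0 by rewrite -size_poly_gt0 ltnW.
split=> //.
  by rewrite poly_unitE; case: eqP sf => // ->.
move=> g h [k ghE].
have [r [u [v [a [b [w [w' [r0 rE a0 b0 [aE bE]]]]]]]]] := ideal_gcd g f0.
have [sw|/size1_polyC rC] := irf _ _ _ a0 aE; last first.
  right; have c0 : r`_0 != 0 by rewrite -polyC_eq0 -rC.
  apply: (primitive_cancel (ufdA c0) prf (m := u * h + v * k)).
  by rewrite -rC rE mulrDl -[v * g * h]mulrA ghE; ring.
left; have wE := size1_polyC sw.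
have c0 : w`_0 * b != 0.
  rewrite mulf_neq0 // -polyC_eq0 -wE; apply/eqP=> w0; move/eqP: aE.
  by rewrite w0 mul0r mulf_eq0 polyC_eq0 (negPf a0) (negPf f0).
apply: (primitive_cancel (ufdA c0) prf (m := w' * a%:P)).
by rewrite polyCM -wE -mulrA bE mulrCA -aE; ring.
Qed.

Lemma factored_frac_irreducible f : (1 < size f)%N -> frac_irreducible f -> factored f.
Proof.
move=> sf irf.
(* Primes of the content divide the leading coefficient. Its part [l] is still to be examined; [m]
   collects the primes already known not to divide [f]. *)
suff H l : factored l -> forall f m, (1 < size f)%N -> frac_irreducible f ->
    lead_coef f = m * l ->
    (forall p, prime_elt p -> divides p m -> ~ divides p%:P f) -> factored f.
  have f0 : lead_coef f != 0 by rewrite lead_coef_eq0 -size_poly_gt0 ltnW.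
  apply: (H _ (ufdA f0) f 1) => //; first by rewrite mul1r.
  by move=> p pp /prime_dvd_unit -/(_ pp (unitr1 _)).
elim=> {f sf irf l} [u uu|p l pp _ IH] f m sf irf lE mP.
  rewrite -[f]mulr1; apply: factored_mulp; last exact/factored_unit/unitr1.
  apply: primitive_irreducible_prime => // p pp pf.
  have : divides p (lead_coef f) by apply: divides_polyCP.
  rewrite lE => -[c mE]; apply: mP pf => //; exists (c / u).
  by rewrite mulrAC -mE mulrK.
have [[g fE]|npf] := classic (divides p%:P f).
  have p0 : p != 0 by case: pp.
  have sg : size f = size g by rewrite fE mulrC mul_polyC size_scale.
  rewrite fE mulrC; apply: factored_mulp; first exact: prime_polyC.
  apply: (IH _ m); first by rewrite -sg.
  - move=> a x y a0 E; have [||] := irf a (p%:P * x) y a0.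
    + by rewrite fE -mulrA -E; ring.
    + by rewrite mul_polyC size_scale //; left.
    + by right.
  - apply: (mulfI p0); rewrite mulrCA -lE fE lead_coefM lead_coefC; ring.
  - move=> q qp qm qg; apply: (mP q qp qm); rewrite fE; exact: divides_mulr.
apply: (IH f (m * p)) => //; first by rewrite lE mulrA.
move=> q qp; have [_ _ qP] := qp => /qP[|qdp]; first exact: mP.
move=> qf; apply: npf; apply: divides_trans qf; apply: divides_polyC.
exact: prime_dvd_prime.
Qed.

Lemma ufd_poly : ufd {poly A}.
Proof.
move=> f; have [m] := ubnP (size f); elim: m => // m IH in f *.
rewrite ltnS => sf f0.
have [s1|s1] := leqP (size f) 1.
  have fE := size1_polyC s1; rewrite fE.
  have : f`_0 != 0 by rewrite -polyC_eq0 -fE.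
  move=> /ufdA; elim=> [u uu|p a pp _ IHa]; first exact/factored_unit/rmorph_unit.
  by rewrite polyCM; apply: factored_mulp => //; apply: prime_polyC.
have [irf|nirf] := classic (frac_irreducible f); first exact: factored_frac_irreducible.
have [a [g [h [a0 E [sg sh]]]]] : exists a g h,
    [/\ a != 0, a%:P * f = g * h & (1 < size g)%N /\ (1 < size h)%N].
  apply: NNPP => H; apply: nirf => a g h a0 E.
  have [|sg] := leqP (size g) 1; first by left.
  have [|sh] := leqP (size h) 1; first by right.
  by case: H; exists a, g, h.
have [g' [h' [fE sg' sh']]] := frac_factor (ufdA a0) f0 E.
have := f0; rewrite fE mulf_eq0 negb_or => /andP[g0 h0].
have := size_mul g0 h0; rewrite -fE sg' sh' => sfE.
have lt x y : (1 < x)%N -> (1 < y)%N -> size f = (x + y).-1 -> (x < m)%N /\ (y < m)%N.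
  by case: x => [|[|x]]; case: y => [|[|y]] // _ _ E1; move: sf; rewrite E1 /= !addSn !addnS /= => E2;
     split; apply: leq_trans E2; rewrite !ltnS ?leq_addr ?leq_addl.
have [lg lh] := lt _ _ sg sh sfE.
by rewrite fE; apply: factored_mul; apply: IH; rewrite ?sg' ?sh'.
Qed.

End PolyUFD.

(** * Iterated polynomial rings *)

(** Variable 0 is the outermost polynomial variable and the others sit in the coefficients.
    One-variable notions thus apply to variable 0, and induction on [n] reaches the rest. *)
Fixpoint ip (C : numClosedFieldType) (n : nat) : idomainType :=
  if n is m.+1 then ({poly ip C m} : idomainType) else C.

Section Substitution.
Variables (C : numClosedFieldType) (R : comNzRingType) (phi : {rmorphism C -> R}).

(** Allowing an arbitrary commutative target ring covers evaluation, linear changes of variables and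
    restriction to lines and planes, all as ring morphisms. *)
Fixpoint sub (n : nat) : ('I_n -> R) -> {rmorphism ip C n -> R} :=
  match n with
  | 0 => fun _ => phi
  | m.+1 => fun s =>
     (horner_morph (fun a => mulrC (s ord0) (sub (fun j => s (lift ord0 j)) a))
       : {rmorphism {poly ip C m} -> R})
  end.

Lemma subS n (s : 'I_n.+1 -> R) (p : {poly ip C n}) :
  sub s (p : ip C n.+1) = (map_poly (sub (fun j => s (lift ord0 j))) p).[s ord0].
Proof. by []. Qed.
End Substitution.

Fixpoint ipC (C : numClosedFieldType) (n : nat) : {rmorphism C -> ip C n} :=
  match n with
  | 0 => (@idfun C : {rmorphism C -> C})
  | m.+1 => ((@polyC (ip C m) \o @ipC C m) : {rmorphism C -> {poly ip C m}})
  end.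

Fixpoint ipvar (C : numClosedFieldType) (n : nat) : 'I_n -> ip C n :=
  match n with
  | 0 => fun _ => 0
  | m.+1 => fun i => if unlift ord0 i is Some j then (ipvar C j)%:P else 'X
  end.

Definition ev (C : numClosedFieldType) n (z : 'I_n -> C) : {rmorphism ip C n -> C} :=
  sub (@idfun C : {rmorphism C -> C}) z.

Section SubstitutionTheory.
Variable C : numClosedFieldType.

Lemma sub_comp (R R' : comNzRingType) (phi : {rmorphism C -> R})
    (psi : {rmorphism R -> R'}) (phi' : {rmorphism C -> R'}) n (s : 'I_n -> R) s' p :
  (forall c, psi (phi c) = phi' c) -> (forall i, psi (s i) = s' i) ->
  psi (sub phi s p) = sub phi' s' p.
Proof.
move=> Hc; elim: n s s' p => [|n IH] s s' p Hs; first exact: Hc.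
rewrite !subS -horner_map Hs -map_poly_comp; congr (_.[_]).
by apply: eq_map_poly => q /=; apply: IH.
Qed.

Lemma eq_sub (R : comNzRingType) (phi : {rmorphism C -> R}) n (s s' : 'I_n -> R) p :
  s =1 s' -> sub phi s p = sub phi s' p.
Proof. by move=> Hs; apply: (sub_comp (psi := idfun)). Qed.

Lemma eq_ev n (z z' : 'I_n -> C) p : z =1 z' -> ev z p = ev z' p.
Proof. exact: eq_sub. Qed.

Lemma sub_var (R : comNzRingType) (phi : {rmorphism C -> R}) n (s : 'I_n -> R) i :
  sub phi s (ipvar C i) = s i.
Proof.
elim: n s i => [|n IH] s i; first by case: i.
rewrite subS /=; case: unliftP => [j|] ->; last by rewrite map_polyX hornerX.
by rewrite map_polyC hornerC /= IH.
Qed.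

Lemma sub_C (R : comNzRingType) (phi : {rmorphism C -> R}) n (s : 'I_n -> R) c :
  sub phi s (ipC C n c) = phi c.
Proof.
elim: n s => [|n IH] s //.
by rewrite subS /= map_polyC hornerC /= IH.
Qed.

Lemma ev_var n (z : 'I_n -> C) i : ev z (ipvar C i) = z i.
Proof. exact: sub_var. Qed.

Lemma ev_C n (z : 'I_n -> C) c : ev z (ipC C n c) = c.
Proof. exact: sub_C. Qed.

Lemma ev_sub m n (z : 'I_m -> C) (s : 'I_n -> ip C m) p :
  ev z (sub (ipC C m) s p) = ev (fun i => ev z (s i)) p.
Proof. by apply: sub_comp => // c; apply: ev_C. Qed.

Lemma ip_ind n (K : ip C n -> Prop) :
  (forall c, K (ipC C n c)) -> (forall i, K (ipvar C i)) ->
  (forall p q, K p -> K q -> K (p + q)) -> (forall p q, K p -> K q -> K (p * q)) ->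
  forall p, K p.
Proof.
elim: n K => [|n IH] K KC KV KD KM; first exact: KC.
have K1 (a : ip C n) : K a%:P.
  apply: (IH (fun a : ip C n => K a%:P)) => [c|i|p q Kp Kq|p q Kp Kq].
  - exact: KC.
  - by have := KV (lift ord0 i); rewrite /= liftK.
  - by rewrite polyCD; apply: KD.
  - by rewrite polyCM; apply: KM.
elim/poly_ind => [|p a Kp]; first by rewrite -polyC0.
apply: (KD (p * 'X) a%:P) => //; apply: (KM p 'X) => //.
by have := KV ord0; rewrite /= unlift_none.
Qed.

Definition pcons n (t : C) (w : 'I_n -> C) : 'I_n.+1 -> C :=
  fun i => if unlift ord0 i is Some j then w j else t.

Lemma pcons0 n t (w : 'I_n -> C) : pcons t w ord0 = t.
Proof. by rewrite /pcons unlift_none. Qed.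

Lemma pconsS n t (w : 'I_n -> C) j : pcons t w (lift ord0 j) = w j.
Proof. by rewrite /pcons liftK. Qed.

Lemma pcons_eta n (z : 'I_n.+1 -> C) : pcons (z ord0) (fun j => z (lift ord0 j)) =1 z.
Proof. by move=> i; rewrite /pcons; case: unliftP => [j|] ->. Qed.

Lemma ev_pcons n t (w : 'I_n -> C) (p : {poly ip C n}) :
  ev (pcons t w) (p : ip C n.+1) = (map_poly (ev w) p).[t].
Proof.
rewrite /ev subS pcons0; congr (_.[_]); apply: eq_map_poly => a /=.
by apply: eq_sub => j; apply: pconsS.
Qed.

Lemma poly_real_roots_eq0 (p : {poly C}) : (forall t, t \is Num.real -> p.[t] = 0) -> p = 0.
Proof.
move=> H; apply/eqP; apply: contraT => p0.
have := max_poly_roots p0 (rs := [seq i%:R | i <- iota 0 (size p)]).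
rewrite size_map size_iota ltnn => -> //.
  by apply/allP=> _ /mapP[i _ ->]; apply/rootP/H/realn.
by rewrite map_inj_uniq ?iota_uniq // => i j /eqP; rewrite eqr_nat => /eqP.
Qed.

(** Zariski density of the real points, one variable at a time; it turns identities at real points
    into polynomial identities. *)
Lemma ev_real_eq0 n (p : ip C n) : (forall z, realvec z -> ev z p = 0) -> p = 0.
Proof.
elim: n p => [|n IH] p H; first by apply: (H (fun=> 0)) => i; rewrite real0.
apply/polyP => i; rewrite coef0; apply: IH => w rw.
have : map_poly (ev w) p = 0.
  apply: poly_real_roots_eq0 => t rt; rewrite -ev_pcons; apply: H => j.
  by rewrite /pcons; case: unlift.
by move/(congr1 (fun q : {poly C} => q`_i)); rewrite coef_map coef0.
Qed.

Lemma ev_inj n (p q : ip C n) : (forall z, ev z p = ev z q) -> p = q.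
Proof.
move=> H; apply/eqP; rewrite -subr_eq0; apply/eqP/ev_real_eq0 => z _.
by rewrite rmorphB H subrr.
Qed.

Lemma ev_real_neq0 n (p : ip C n) : p != 0 -> exists2 z, realvec z & ev z p != 0.
Proof.
move=> p0; apply: NNPP => H; case/eqP: p0; apply: ev_real_eq0 => z rz.
by apply/eqP; apply: contraT => pz; case: H; exists z.
Qed.

(** If variable 0 occurs, choose the other coordinates off the zeros of the leading coefficient and
    solve for variable 0 by algebraic closedness; otherwise pass to the coefficients. *)
Lemma ev_neq0_unit n (p : ip C n) : (forall z, ev z p != 0) -> p \is a GRing.unit.
Proof.
elim: n p => [|n IH] p H; first by rewrite unitfE; apply: (H (fun=> 0)).
have [s1|s1] := leqP (size (p : {poly ip C n})) 1.
  have pE := size1_polyC s1; rewrite pE.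
  apply: rmorph_unit; apply: IH => w.
  by have := H (pcons 0 w); rewrite ev_pcons {1}pE map_polyC hornerC.
have l0 : lead_coef (p : {poly ip C n}) != 0 by rewrite lead_coef_eq0 -size_poly_gt0 ltnW.
have [w _ lw] := ev_real_neq0 l0.
have : (size (map_poly (ev w) p) != 1)%N.
  by rewrite size_map_poly_id0 // neq_ltn s1 orbT.
by case/closed_rootP => t /rootP; rewrite -ev_pcons => /eqP; rewrite (negPf (H _)).
Qed.

Lemma ufd_ip n : ufd (ip C n).
Proof.
elim: n => [|n IH]; last exact: ufd_poly.
by move=> a a0; apply: factored_unit; rewrite unitfE.
Qed.

(** * Coefficients and the translation of term lists *)

Fixpoint icoef n : ip C n -> ('I_n -> nat) -> C :=
  match n with
  | 0 => fun p _ => p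
  | m.+1 => fun p k => icoef ((p : {poly ip C m})`_(k ord0)) (fun j => k (lift ord0 j))
  end.

Lemma icoefD n (p q : ip C n) k : icoef (p + q) k = icoef p k + icoef q k.
Proof. by elim: n p q k => [|n IH] p q k //=; rewrite coefD IH. Qed.

Lemma icoef0 n k : icoef (0 : ip C n) k = 0.
Proof. by elim: n k => [|n IH] k //=; rewrite coef0 IH. Qed.

Lemma icoef_sum n I (r : seq I) (F : I -> ip C n) k :
  icoef (\sum_(i <- r) F i) k = \sum_(i <- r) icoef (F i) k.
Proof.
elim: r => [|i r IH]; first by rewrite !big_nil icoef0.
by rewrite !big_cons icoefD IH.
Qed.

Lemma eq_icoef n (p : ip C n) k k' : k =1 k' -> icoef p k = icoef p k'.
Proof.
elim: n p k k' => [|n IH] p k k' E //=; rewrite E; apply: IH => j; exact: E.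
Qed.

Lemma icoef_inj n (p q : ip C n) : (forall k : expo n, icoef p (tnth k) = icoef q (tnth k)) -> p = q.
Proof.
elim: n p q => [|n IH] p q H; first exact: (H [tuple]).
apply/polyP => i; apply: IH => k.
have := H [tuple of i :: k] => /=; rewrite tnth0.
rewrite (eq_icoef _ (k' := tnth k)) => [->|j]; last by rewrite tnthS.
by apply: eq_icoef => j; rewrite tnthS.
Qed.

Definition monomial n (k : 'I_n -> nat) : ip C n := \prod_(i < n) ipvar C i ^+ k i.

Lemma icoef_monomial n c (k k' : 'I_n -> nat) :
  icoef (ipC C n c * monomial k) k' = if [forall i, k i == k' i] then c else 0.
Proof.
elim: n k k' => [|n IH] k k'.
  by rewrite /monomial big_ord0 mulr1 /=; case: forallP => // -[] [].
rewrite /monomial big_ord_recl /= unlift_none.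
under eq_bigr => i _ do rewrite liftK -rmorphXn.
rewrite -rmorph_prod mulrCA -polyCM mulrC coefCM coefXn /=.
have [E|E] := eqVneq (k' ord0) (k ord0).
  rewrite mulr1 IH; congr (if _ then _ else _); apply/forallP/forallP => H i.
    by case: (unliftP ord0 i) => [j|] ->; rewrite ?E.
  exact: H.
rewrite mulr0 icoef0; case: forallP => // /(_ ord0).
by rewrite eq_sym (negPf E).
Qed.

Lemma ev_monomial n (z : 'I_n -> C) k : ev z (monomial k) = \prod_(i < n) z i ^+ k i.
Proof. by rewrite rmorph_prod; apply: eq_bigr => i _; rewrite rmorphXn ev_var. Qed.

Definition toip n (f : mpoly C n) : ip C n :=
  \sum_(t <- f) ipC C n t.1 * monomial (tnth t.2).

Lemma ev_toip n (f : mpoly C n) z : ev z (toip f) = meval f z.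
Proof.
rewrite rmorph_sum; apply: eq_bigr => t _.
by rewrite rmorphM ev_C ev_monomial.
Qed.

Lemma icoef_toip n (f : mpoly C n) k : icoef (toip f) (tnth k) = mcoeff f k.
Proof.
rewrite icoef_sum /mcoeff [RHS]big_mkcond /=; apply: eq_bigr => t _.
rewrite icoef_monomial; congr (if _ then _ else _).
by apply/forallP/eqP => [H|-> //]; apply: eq_from_tnth => i; apply/eqP.
Qed.

Lemma mpeqP n (f g : mpoly C n) : mpeq f g <-> toip f = toip g.
Proof.
split=> [H|H] ; first by apply: icoef_inj => k; rewrite !icoef_toip.
by move=> k; rewrite -!icoef_toip H.
Qed.

Lemma toip_nonzero n (f : mpoly C n) : mp_nonzero f <-> toip f != 0.
Proof.
split=> [[k]|f0]; first by apply: contraNneq => E; rewrite -icoef_toip E icoef0.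
apply: NNPP => H; case/eqP: f0; apply: icoef_inj => k; rewrite icoef0 icoef_toip.
by apply/eqP; apply: contraT => fk; case: H; exists k.
Qed.

Lemma toip_mul n (f g : mpoly C n) : toip (mpmul f g) = toip f * toip g.
Proof.
rewrite /toip big_allpairs_dep mulr_suml; apply: eq_bigr => a _ /=.
rewrite mulr_sumr; apply: eq_bigr => b _; rewrite rmorphM mulrACA; congr (_ * _).
by rewrite -big_split; apply: eq_bigr => i _; rewrite tnth_mktuple exprD.
Qed.

Lemma toip_scale n c (f : mpoly C n) : toip (mpscale c f) = ipC C n c * toip f.
Proof.
rewrite /toip big_map mulr_sumr; apply: eq_bigr => a _ /=.
by rewrite rmorphM mulrA.
Qed.

Lemma monomial0 n : monomial (tnth (expo0 n)) = 1.
Proof. by apply: big1 => i _; rewrite tnth_mktuple. Qed.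

Lemma monomialU n (i : 'I_n) : monomial (tnth (expoU i)) = ipvar C i.
Proof.
rewrite /monomial (bigD1 i) //= tnth_mktuple eqxx big1 ?mulr1 // => j ji.
by rewrite tnth_mktuple eq_sym (negPf ji).
Qed.

Lemma toip_prod n (fs : seq (mpoly C n)) : toip (mpprod fs) = \prod_(f <- fs) toip f.
Proof.
elim: fs => [|f fs IH]; last by rewrite big_cons -IH -toip_mul.
by rewrite big_nil /toip big_seq1 rmorph1 mul1r monomial0.
Qed.

Lemma meval_linpoly n a0 (a z : 'I_n -> C) :
  meval (linpoly a0 a) z = a0 + \sum_(i < n) a i * z i.
Proof.
rewrite -ev_toip /toip big_cons monomial0 mulr1 big_map big_enum rmorphD ev_C.
by rewrite rmorph_sum; congr (_ + _); apply: eq_bigr => i _; rewrite monomialU rmorphM ev_C ev_var.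
Qed.

Lemma toip_surj n (p : ip C n) : exists f, toip f = p.
Proof.
move: p; apply: ip_ind => [c|i|p q [f <-] [g <-]|p q [f <-] [g <-]].
- by exists [:: (c, expo0 n)]; rewrite /toip big_seq1 monomial0 mulr1.
- by exists [:: (1, expoU i)]; rewrite /toip big_seq1 monomialU rmorph1 mul1r.
- by exists (f ++ g); rewrite /toip big_cat.
- by exists (mpmul f g); rewrite toip_mul.
Qed.

(** The coefficient of degree [k] in variable 0 is homogeneous of degree [d - k] in the remaining
    variables. *)
Lemma icoef_homogeneous n d (p : ip C n) :
  (forall k, icoef p k != 0 -> (\sum_(i < n) k i)%N = d) ->
  forall l z, ev (fun i => l * z i) p = l ^+ d * ev z p.
Proof.
elim: n d p => [|n IH] d p H l z.
  have [->|p0] := eqVneq p 0; first by rewrite !rmorph0 mulr0.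
  by have := H (fun=> 0%N) p0; rewrite big_ord0 => <-; rewrite expr0 mul1r.
have Hk k (m : 'I_n -> nat) :
    icoef (p : {poly ip C n})`_k m != 0 -> (k + \sum_(i < n) m i)%N = d.
  pose k' i := if unlift ord0 i is Some j then m j else k.
  have k'S j : k' (lift ord0 j) = m j by rewrite /k' liftK.
  have k'0 : k' ord0 = k by rewrite /k' unlift_none.
  have := H k'; rewrite /= k'0 (eq_icoef _ k'S) big_ord_recl k'0 => E /E <-.
  by congr addn; apply: eq_bigr => j _.
pose w j := z (lift ord0 j).
have -> : ev (fun i => l * z i) p = (map_poly (ev (fun j => l * w j)) p).[l * z ord0].
  by rewrite -ev_pcons; apply: eq_ev => i; rewrite /pcons; case: unliftP => [j|] ->.
have -> : ev z p = (map_poly (ev w) p).[z ord0].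
  by rewrite -ev_pcons; apply: eq_ev => i; rewrite pcons_eta.
have sz (f : {rmorphism ip C n -> C}) : (size (map_poly f p) <= size (p : {poly ip C n}))%N.
  exact: size_poly.
rewrite !(horner_coef_wide _ (sz _)) mulr_sumr; apply: eq_bigr => k _.
rewrite !coef_map /=; have [kd|kd] := leqP k d.
  rewrite (IH (d - k)%N) ?exprMn; first by rewrite -{2}(subnK kd) exprD; ring.
  move=> m /(Hk k) <-; by rewrite addKn.
(* Beyond degree [d] the truncated difference [d - k] would be wrong, but there the coefficient
   vanishes. *)
suff -> : (p : {poly ip C n})`_k = 0 by rewrite !rmorph0 !mul0r mulr0.
apply: icoef_inj => m; rewrite icoef0; apply/eqP; apply: contraT => /(Hk k) E.
by move: kd; rewrite -E ltnNge leq_addr.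
Qed.

Lemma meval_homogeneous n d (f : mpoly C n) :
  (forall m, mcoeff f m != 0 -> tdeg m = d) ->
  forall l z, meval f (fun i => l * z i) = l ^+ d * meval f z.
Proof.
move=> H l z; rewrite -!ev_toip; apply: icoef_homogeneous => k.
rewrite (eq_icoef _ (k' := tnth [tuple k i | i < n])) => [|i]; last by rewrite tnth_mktuple.
rewrite icoef_toip => /H <-; apply: eq_bigr => i _; by rewrite tnth_mktuple.
Qed.

Lemma mp_constant_toip n (f : mpoly C n) :
  mp_constant f <-> exists c, toip f = ipC C n c.
Proof.
split=> [H|[c E] k].
  exists (meval f (fun=> 0)); apply: ev_inj => z; rewrite ev_C ev_toip.
  have /(_ 0 z) := meval_homogeneous H; rewrite expr0 mul1r => <-.
  by rewrite -!ev_toip; apply: eq_ev => i; rewrite mul0r.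
rewrite -icoef_toip E -[ipC _ _ _]mulr1 -(monomial0 n) icoef_monomial.
case: forallP => [K _|]; last by rewrite eqxx.
by apply: big1 => i _; rewrite -(eqP (K i)) tnth_mktuple.
Qed.

End SubstitutionTheory.

(** * Zero-free polynomials on the unit disc *)

Section SchurCohn.
Variable C : numClosedFieldType.
Implicit Types (p q : {poly C}) (d : nat) (r w x y : C).

Definition disc_free q := forall w, `|w| <= 1 -> q.[w] != 0.

(* The reciprocal polynomial [w^d * conj (q (1 / conj w))] for the nominal degree [d]. *)
Definition crev d q : {poly C} := \poly_(i < d.+1) (q`_(d - i))^*.

(** The Schur transform: the conjugate of [q_0] times [q], minus [q_d] times [crev d q]. Its
    coefficient of degree [d] cancels, so the truncation lowers the nominal degree. *)
Definition schur_step d q : {poly C} :=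
  \poly_(i < d) ((q`_0)^* * q`_i - q`_d * (q`_(d - i))^*).

(** The Blaschke factor estimate, for a root [r] outside the closed disc. *)
Lemma normB_conj_le r w : `|w| <= 1 -> 1 < `|r| -> `|1 - r^* * w| <= `|w - r|.
Proof.
move=> w1 r1; rewrite -(@ler_pXn2r _ 2) ?nnegrE // -subr_ge0.
have -> : `|w - r| ^+ 2 - `|1 - r^* * w| ^+ 2 = (`|r| ^+ 2 - 1) * (1 - `|w| ^+ 2).
  by rewrite !normCK !(rmorphB, rmorphM, rmorph1) /= conjCK; ring.
by rewrite mulr_ge0 // subr_ge0 ?expr_ge1 ?expr_le1 // ltW.
Qed.

Lemma crevM d q r : (size q <= d.+1)%N ->
  crev d.+1 (q * ('X - r%:P)) = crev d q * (1 - r^* *: 'X).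
Proof.
move=> sq; apply/polyP => i.
rewrite [crev d q * _]mulrBr mulr1 -scalerAr coefB coefZ coefMX !coef_poly mulrBr coefB coefMX coefMC.
case: i => [|i] /=.
  by rewrite !subn0 [q`_d.+1]nth_default // mul0r subr0 mulr0 subr0.
rewrite subSS !ltnS; have [lt|gt|->] := ltngtP i d.
- rewrite rmorphB rmorphM /= [r^* * _]mulrC subn_eq0 leqNgt lt /=.
  by rewrite -subnS.
- by rewrite mulr0 subr0.
- by rewrite subnn /= sub0r rmorphN rmorphM /= mulrC sub0r.
Qed.

(** All roots lie outside the disc; they are split off one by one and each contributes a Blaschke
    factor. Surplus nominal degree only contributes powers of [w]. *)
Lemma crev_le d q : (size q <= d.+1)%N -> disc_free q ->
  forall w, `|w| <= 1 -> `|(crev d q).[w]| <= `|q.[w]|.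
Proof.
elim: d q => [|d IH] q sq nz w w1.
  rewrite (size1_polyC sq) hornerC horner_poly big_ord1 subn0 expr0 mulr1.
  by rewrite coefC /= norm_conjC.
have [s1|s1] := leqP (size q) 1.
  rewrite (size1_polyC s1) hornerC horner_poly big_ord_recr /= big1 => [|i _].
    by rewrite subnn coefC /= add0r normrM norm_conjC normrX ler_piMr // exprn_ile1.
  by rewrite coefC subn_eq0 leqNgt ltn_ord rmorph0 mul0r.
have /closed_rootP[r rr] : (size q != 1)%N by rewrite neq_ltn s1 orbT.
have r1 : 1 < `|r|.
  rewrite real_ltNge ?real1 ?normr_real //; apply/negP => /nz.
  by rewrite (rootP rr) eqxx.
have [p qE] := factor_theorem q r rr.
have p0 : p != 0 by apply: contraTneq s1 => p0; rewrite qE p0 mul0r size_poly0.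
have sp : (size p <= d.+1)%N by move: sq; rewrite qE size_Mmonic ?monicXsubC // size_XsubC addn2.
rewrite qE crevM // !hornerM normrM normrM ler_pM //.
  by apply: IH => // u u1; have := nz u u1; rewrite qE hornerM mulf_eq0 => /norP[].
by rewrite !hornerE normB_conj_le.
Qed.

Lemma crev0 d q : (crev d q).[0] = (q`_d)^*.
Proof. by rewrite horner_coef0 coef_poly subn0. Qed.

(** Write [q = p ('X - r)] with [1 < |r|]. Then [|p_d| <= |p_0|] by [crev_le] at the origin, and the
    factor [|r|] in the constant term makes the inequality strict. *)
Lemma disc_free_coef d q : (size q <= d.+2)%N -> disc_free q -> `|q`_d.+1| < `|q`_0|.
Proof.
move=> sq nz; have q0 : q`_0 != 0 by rewrite -horner_coef0 nz // normr0 ler01.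
have [s1|s1] := leqP (size q) 1.
  by rewrite nth_default ?normr0 ?normr_gt0 //; apply: leq_trans s1 _.
have /closed_rootP[r rr] : (size q != 1)%N by rewrite neq_ltn s1 orbT.
have r1 : 1 < `|r|.
  rewrite real_ltNge ?real1 ?normr_real //; apply/negP => /nz.
  by rewrite (rootP rr) eqxx.
have [p qE] := factor_theorem q r rr.
have p0 : p != 0 by apply: contraTneq s1 => p0; rewrite qE p0 mul0r size_poly0.
have sp : (size p <= d.+1)%N by move: sq; rewrite qE size_Mmonic ?monicXsubC // size_XsubC addn2.
have nzp : disc_free p.
  by move=> u u1; have := nz u u1; rewrite qE hornerM mulf_eq0 => /norP[].
have := crev_le sp nzp (w := 0); rewrite normr0 ler01 => /(_ isT).
rewrite crev0 norm_conjC horner_coef0 => le.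
rewrite qE mulrBr !coefB !coefMX !coefMC /= [p`_d.+1]nth_default // mul0r subr0 sub0r normrN normrM.
apply: le_lt_trans le _; rewrite ltr_pMr // normr_gt0.
by rewrite -horner_coef0 nzp // normr0 ler01.
Qed.

Lemma coef_crev d q i : (i <= d)%N -> (crev d q)`_i = (q`_(d - i))^*.
Proof. by move=> id; rewrite coef_poly ltnS id. Qed.

Lemma schur_stepE d q : (size q <= d.+1)%N ->
  schur_step d q = (q`_0)^* *: q - q`_d *: crev d q.
Proof.
move=> sq; apply/polyP => i; rewrite coefB !coefZ !coef_poly ltnS.
have [lt|lt|->] := ltngtP i d => //.
  by rewrite [q`_i]nth_default ?mulr0 ?subr0 //; apply: leq_trans sq _.
by rewrite subnn mulrC subrr.
Qed.

Lemma crevB d p q : crev d (p - q) = crev d p - crev d q.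
Proof.
apply/polyP => i; rewrite coefB !coef_poly; case: ifP => _; last by rewrite subr0.
by rewrite coefB rmorphB.
Qed.

Lemma crevZ d c q : crev d (c *: q) = c^* *: crev d q.
Proof.
apply/polyP => i; rewrite coefZ !coef_poly; case: ifP => _; last by rewrite mulr0.
by rewrite coefZ rmorphM.
Qed.

Lemma crevK d q : (size q <= d.+1)%N -> crev d (crev d q) = q.
Proof.
move=> sq; apply/polyP => i; rewrite coef_poly; case: ltnP => [lid|le].
  by rewrite coef_crev ?leq_subr // subKn // conjCK.
by rewrite nth_default //; apply: leq_trans sq _.
Qed.

Lemma schur_step_inv d q : (size q <= d.+1)%N ->
  (`|q`_0| ^+ 2 - `|q`_d| ^+ 2) *: q =
  q`_0 *: schur_step d q + q`_d *: crev d (schur_step d q).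
Proof.
move=> sq; rewrite schur_stepE // crevB !crevZ crevK // conjCK !normCK.
by rewrite -!mul_polyC !(rmorphB, rmorphM) /=; ring.
Qed.

Lemma crevS d q : (size q <= d.+1)%N -> crev d.+1 q = crev d q * 'X.
Proof.
move=> sq; apply/polyP => -[|i]; rewrite coefMX !coef_poly ?subSS //=.
by rewrite subn0 nth_default // rmorph0.
Qed.

(** The Schur-Cohn criterion. In either direction a zero in the disc would equate two terms of which
    [crev_le] and the strict inequality between [|q_0|] and [|q_(d+1)|] make one smaller. *)
Lemma disc_free_schur d q : (size q <= d.+2)%N ->
  disc_free q <-> 0 < `|q`_0| ^+ 2 - `|q`_d.+1| ^+ 2 /\ disc_free (schur_step d.+1 q).
Proof.
move=> sq; have sqr a b : 0 <= a -> 0 <= b -> (0 < a ^+ 2 - b ^+ 2 :> C) = (b < a).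
  by move=> a0 b0; rewrite subr_gt0 ltr_pXn2r ?nnegrE.
rewrite sqr //; split=> [nz|[lt nz] w w1].
  have lt := disc_free_coef sq nz; split=> // w w1.
  rewrite schur_stepE // !hornerE subr_eq0; apply/eqP => E.
  have := nz w w1; rewrite -normr_gt0 => q0.
  have : `|(q`_0)^* * q.[w]| <= `|q`_d.+1| * `|q.[w]|.
    by rewrite E normrM ler_wpM2l // crev_le.
  rewrite normrM norm_conjC ler_pM2r // => le.
  by have := le_lt_trans le lt; rewrite ltxx.
have ss : (size (schur_step d.+1 q) <= d.+1)%N by apply: size_poly.
apply/eqP => qw; have := congr1 (fun p => p.[w]) (schur_step_inv sq).
rewrite crevS // hornerD !hornerZ hornerMX qw mulr0 => /esym/eqP; rewrite addr_eq0 => /eqP E.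
have := nz w w1; rewrite -normr_gt0 => q0.
have : `|q`_0 * (schur_step d.+1 q).[w]| <= `|q`_d.+1| * `|(schur_step d.+1 q).[w]|.
  rewrite E normrN [leLHS]normrM ler_wpM2l // normrM -[leRHS]mulr1 ler_pM //.
  exact: crev_le.
rewrite normrM ler_pM2r // => le.
by have := le_lt_trans le lt; rewrite ltxx.
Qed.
End SchurCohn.

(** * One-parameter families of polynomials on the disc *)

Section Family.
Variable C : numClosedFieldType.
Implicit Types (p q : {poly C}) (d : nat) (r w x y z : C).

Lemma poly_rootsP p : p != 0 -> {rs : seq C | forall x, root p x -> x \in rs}.
Proof.
move=> p0; have [rs pE] := closed_field_poly_normal p; exists rs => x.
by rewrite {1}pE rootZ ?lead_coef_eq0 // root_prod_XsubC.
Qed.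

Lemma horner_conj p x : x \is Num.real -> (map_poly Num.conj p).[x] = (p.[x])^*.
Proof. by move=> /CrealP xr; rewrite -horner_map /= xr. Qed.

(** No completeness is involved: a real root outside the interval contributes factors of equal sign
    at [a] and [b], and a conjugate pair contributes a positive quadratic. *)
Lemma poly_real_ivt p a b : map_poly Num.conj p = p ->
  a \is Num.real -> b \is Num.real -> a <= b ->
  (forall x, a <= x <= b -> ~~ root p x) -> 0 < p.[a] * p.[b].
Proof.
have [m] := ubnP (size p); elim: m => // m IH in p *.
rewrite ltnS => sp pc ar br ab nr.
have [s1|s1] := leqP (size p) 1.
  have pE := size1_polyC s1; have := nr a; rewrite lexx ab => /(_ isT).
  move: pc; rewrite pE rootC !hornerC map_polyC /= => /polyC_inj cE c0.
  by rewrite -{2}cE -normCK exprn_gt0 // normr_gt0.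
have /closed_rootP[r rr] : (size p != 1)%N by rewrite neq_ltn s1 orbT.
have [q pE] := factor_theorem p r rr.
have q0 : q != 0 by apply: contraTneq s1 => q0; rewrite pE q0 mul0r size_poly0.
have sq : (size q < size p)%N by rewrite pE size_Mmonic ?monicXsubC // size_XsubC addn2.
have X0 z := negbT (polyXsubC_eq0 z).
have [rreal|rnreal] := boolP (r \is Num.real).
  have qc : map_poly Num.conj q = q.
    apply: (mulIf (X0 r)).
    by rewrite -pE -[in RHS]pc pE rmorphM /= map_polyXsubC /= (CrealP rreal).
  have nrq x : a <= x <= b -> ~~ root q x.
    by move/nr; rewrite pE rootM => /norP[].
  rewrite pE !hornerM !hornerXsubC mulrACA.
  apply: mulr_gt0; first exact: (IH q (leq_trans sq sp) qc ar br ab nrq).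
  have [ra|ar'] := real_ltP rreal ar.
    by rewrite mulr_gt0 // subr_gt0 //; apply: lt_le_trans ab.
  have [rb|rb'] := real_ltP br rreal.
    by rewrite nmulr_lgt0 subr_lt0 //; apply: le_lt_trans rb.
  by have := nr r; rewrite ar' rb' rr => /(_ isT).
have : root q r^*.
  have : root p r^* by rewrite -pc /root horner_map /= fmorph_eq0.
  by rewrite pE rootM root_XsubC => /orP[//|/eqP/CrealP]; rewrite (negPf rnreal).
case/factor_theorem=> h qE; pose t := ('X - (r^*)%:P) * ('X - r%:P).
have {}pE : p = h * t by rewrite pE qE mulrA.
have tc : map_poly Num.conj t = t.
  by rewrite /t rmorphM /= !map_polyXsubC /= conjCK mulrC.
have hc : map_poly Num.conj h = h.
  apply: (@mulIf _ t); first by rewrite mulf_neq0.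
  by rewrite -pE -[in RHS]pc pE rmorphM /= tc.
have tpos x : x \is Num.real -> 0 < t.[x].
  move=> xr; rewrite hornerM !hornerXsubC mulrC.
  rewrite -{2}(CrealP xr) -rmorphB -normCK exprn_gt0 // normr_gt0 subr_eq0.
  by apply: contraNneq rnreal => <-.
have sh : (size h < m)%N.
  apply: leq_trans sp; apply: leq_trans sq.
  have [->|h0] := eqVneq h 0; first by rewrite size_poly0.
  by rewrite qE size_Mmonic ?monicXsubC // size_XsubC addn2 ltnS leqnSn.
rewrite pE (hornerM h t a) (hornerM h t b) mulrACA; apply: mulr_gt0; last by rewrite mulr_gt0 ?tpos.
by apply: IH => // x /nr; rewrite pE rootM => /norP[].
Qed.

(* The truth of [A] on [[a, b]] can only change at a point of [rs]. *)
Definition const_off (A : C -> Prop) (rs : seq C) a b := forall a' b',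
  a <= a' -> a' <= b' -> b' <= b ->
  (forall x, a' <= x <= b' -> x \notin rs) -> (A a' <-> A b').

Definition locally_const (A : C -> Prop) a b := forall x, a <= x <= b ->
  exists2 e, 0 < e & forall y, a <= y <= b -> `|y - x| < e -> (A x <-> A y).

Lemma const_off_sub A rs a b a' b' : a <= a' -> b' <= b ->
  const_off A rs a b -> const_off A rs a' b'.
Proof.
move=> aa bb H x y ax xy yb; apply: H => //; first exact: le_trans ax.
exact: le_trans bb.
Qed.

Lemma const_off_cons A r rs a b : ~~ (a <= r <= b) ->
  const_off A (r :: rs) a b -> const_off A rs a b.
Proof.
move=> nr H x y ax xy yb K; apply: H => // z /andP[xz zy]; rewrite inE negb_or K ?xz //.
rewrite andbT; apply: contraNneq nr => <-.
by rewrite (le_trans ax xz) (le_trans zy yb).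
Qed.

Lemma locally_const_sub A a b a' b' : a <= a' -> b' <= b ->
  locally_const A a b -> locally_const A a' b'.
Proof.
move=> aa bb H x /andP[ax xb]; have [|e e0 K] := H x.
  by rewrite (le_trans aa ax) (le_trans xb bb).
exists e => // y /andP[ay yb]; apply: K.
by rewrite (le_trans aa ay) (le_trans yb bb).
Qed.

(** A substitute for connectedness of the interval. Near an exceptional point [r] local constancy
    carries the truth value from [r - h] to [r + h], and the intervals left over no longer contain
    [r]. *)
Lemma locally_const_const A rs a b : const_off A rs a b ->
  a \is Num.real -> b \is Num.real -> a <= b -> locally_const A a b -> (A a <-> A b).
Proof.
elim: rs a b => [|r rs IH] a b H ar br ab loc; first exact: H.
have [/andP[ra rb]|nr] := boolP (a <= r <= b); last exact: (IH _ _ (const_off_cons nr H)).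
have rreal : r \is Num.real by rewrite -[r](subrK a) rpredD // ger0_real // subr_ge0.
have [|e e0 K] := loc r; first by rewrite ra.
pose h := e / 2; have h0 : 0 < h by rewrite divr_gt0.
have he : `|h| < e by rewrite gtr0_norm // ltr_pdivrMr // mulr_natr mulr2n ltrDl.
have hr : h \is Num.real by rewrite gtr0_real.
have E1 : A a <-> A r.
  have [le|lt] := real_leP (rpredB rreal hr) ar.
    symmetry; apply: K; first by rewrite lexx.
    rewrite distrC ger0_norm ?subr_ge0 // (le_lt_trans _ he) // gtr0_norm //.
    by rewrite lerBlDl -lerBlDr.
  have rhr : r - h <= r by rewrite gerBl ltW.
  have E : A r <-> A (r - h).
    apply: K; first by rewrite (ltW lt) (le_trans rhr).
    by rewrite addrAC subrr add0r normrN.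
  rewrite E; apply: IH => //; rewrite ?rpredB ?(ltW lt) //.
    apply: (@const_off_cons _ r); first by rewrite [r <= _]lt_geF ?andbF // gtrBl.
    by apply: const_off_sub H => //; apply: le_trans rb.
  by apply: locally_const_sub loc => //; apply: le_trans rb.
rewrite E1.
have [le|lt] := real_leP br (rpredD rreal hr).
  apply: K; first by rewrite lexx andbT.
  rewrite ger0_norm ?subr_ge0 // (le_lt_trans _ he) // gtr0_norm //.
  by rewrite lerBlDl.
have rhr : r <= r + h by rewrite lerDl ltW.
have E : A r <-> A (r + h).
  apply: K; first by rewrite (ltW lt) andbT (le_trans ra).
  by rewrite addrAC subrr add0r.
rewrite E; apply: IH => //; rewrite ?rpredD ?(ltW lt) //.
  apply: (@const_off_cons _ r); first by rewrite lt_geF // ltrDl.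
  by apply: const_off_sub H => //; apply: le_trans rhr.
by apply: locally_const_sub loc => //; apply: le_trans rhr.
Qed.

(** [F i] is the coefficient of degree [i], itself a polynomial in the parameter [z]. *)
Definition slice d (F : nat -> {poly C}) z : {poly C} := \poly_(i < d.+1) (F i).[z].

(** Induction along the Schur-Cohn recursion: each level adds the sign condition on one real
    polynomial [D] in the parameter, which changes only at roots of [D]. For real parameters
    conjugating values amounts to conjugating coefficients, so the transform is again such a
    family. *)
Lemma disc_free_const_off d (F : nat -> {poly C}) :
  exists rs : seq C, forall a b, a \is Num.real -> b \is Num.real -> a <= b ->
    (forall x, a <= x <= b -> x \notin rs) ->
    (disc_free (slice d F a) <-> disc_free (slice d F b)).
Proof.
elim: d F => [|d IH] F.
  have E z : disc_free (slice 0 F z) <-> ~~ root (F 0) z.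
    split=> [/(_ 0)|nr w _].
      by rewrite normr0 ler01 horner_coef0 coef_poly => /(_ isT).
    by rewrite horner_poly big_ord1 mulr1.
  have [F0|F0] := eqVneq (F 0) 0.
    by exists [::] => a b _ _ _ _; rewrite !E F0 !root0.
  have [rs rsP] := poly_rootsP F0; exists rs => a b _ _ ab nrs.
  rewrite !E; split=> _; apply/negP => /rsP; apply/negP/nrs.
    by rewrite ab lexx.
  by rewrite ab lexx.
pose cF i := map_poly Num.conj (F i).
pose G i := cF 0%N * F i - F d.+1 * cF (d.+1 - i)%N.
have [rs' rsP'] := IH G.
pose D := F 0 * cF 0%N - F d.+1 * cF d.+1.
have cD : map_poly Num.conj D = D.
  have K i : map_poly Num.conj (cF i) = F i.
    by rewrite /cF -map_poly_comp map_poly_id // => x _ /=; rewrite conjCK.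
  by rewrite /D rmorphB !rmorphM /= !K /= mulrC [cF d.+1 * _]mulrC.
have E z : z \is Num.real ->
    disc_free (slice d.+1 F z) <-> 0 < D.[z] /\ disc_free (slice d G z).
  move=> zr; have S := @disc_free_schur C d (slice d.+1 F z) (size_poly _ _).
  rewrite S {S}.
  have -> : schur_step d.+1 (slice d.+1 F z) = slice d G z.
    apply/polyP => i; rewrite !coef_poly; case: ltnP => // id.
    rewrite [(i < d.+2)%N]ltnW // ltnSn (leq_ltn_trans (leq_subr i d.+1)) //=.
    by rewrite /G hornerD hornerN !hornerM !horner_conj.
  by rewrite !coef_poly /= ltnSn !normCK /D hornerD hornerN !hornerM !horner_conj.
have [rs rsP] : exists rs : seq C, forall a b, a \is Num.real -> b \is Num.real -> a <= b ->
    (forall x, a <= x <= b -> x \notin rs) -> (0 < D.[a]) = (0 < D.[b]).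
  have [D0|D0] := eqVneq D 0; first by exists [::] => a b; rewrite D0 !horner0.
  have [rs rsP] := poly_rootsP D0; exists rs => a b ar br ab nrs.
  have : 0 < D.[a] * D.[b] by apply: poly_real_ivt => // x /nrs; exact: contra (@rsP x).
  by move=> Dab; apply/idP/idP => D1; [rewrite -(pmulr_rgt0 _ D1)|rewrite -(pmulr_lgt0 _ D1)].
exists (rs ++ rs') => a b ar br ab nrs.
have nrs1 x : a <= x <= b -> x \notin rs by move/nrs; rewrite mem_cat => /norP[].
have nrs2 x : a <= x <= b -> x \notin rs' by move/nrs; rewrite mem_cat => /norP[].
by rewrite !E // (rsP a b) // (rsP' a b).
Qed.

Lemma poly_lipschitz p x : exists2 K, 0 <= K &
  forall y, `|y - x| <= 1 -> `|p.[y] - p.[x]| <= K * `|y - x|.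
Proof.
elim/poly_ind: p => [|p c [K K0 IH]].
  by exists 0 => // y _; rewrite !horner0 subrr normr0 mul0r.
exists (K * (`|x| + 1) + `|p.[x]|) => [|y yx]; first by rewrite addr_ge0 ?mulr_ge0 ?addr_ge0.
rewrite !hornerMXaddC.
have -> : p.[y] * y + c - (p.[x] * x + c) = (p.[y] - p.[x]) * y + p.[x] * (y - x) by ring.
rewrite [leRHS]mulrDl (le_trans (ler_normD _ _)) // !normrM lerD2r mulrAC ler_pM ?IH //.
by rewrite -[y in leLHS](subrK x) addrC (le_trans (ler_normD _ _)) // lerD2l.
Qed.

Lemma slice_lipschitz d (F : nat -> {poly C}) x : exists2 K, 0 <= K &
  forall y, `|y - x| <= 1 -> forall w, `|w| <= 1 ->
  `|(slice d F y).[w] - (slice d F x).[w]| <= K * `|y - x|.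
Proof.
elim: d => [|d [K K0 IH]].
  have [K K0 H] := poly_lipschitz (F 0) x; exists K => // y yx w _.
  by rewrite !horner_poly !big_ord1 !mulr1 H.
have [L L0 H] := poly_lipschitz (F d.+1) x; exists (K + L); first exact: addr_ge0.
move=> y yx w w1; have E z : (slice d.+1 F z).[w] = (slice d F z).[w] + (F d.+1).[z] * w ^+ d.+1.
  by rewrite !horner_poly big_ord_recr.
rewrite !E opprD addrACA -mulrBl [leRHS]mulrDl (le_trans (ler_normD _ _)) // lerD ?IH //.
by rewrite normrM -[leRHS]mulr1 ler_pM ?H // normrX exprn_ile1.
Qed.

(** In place of compactness, the bound is explicit: each root [r] satisfies [|r| - 1 <= |w - r|]. *)
Lemma disc_free_bound q : disc_free q ->
  exists2 m, 0 < m & forall w, `|w| <= 1 -> m <= `|q.[w]|.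
Proof.
move=> nz; have [rs qE] := closed_field_poly_normal q.
have q0 : q != 0 by apply/eqP => q0; have := nz 0; rewrite normr0 ler01 q0 horner0 eqxx => /(_ isT).
have rs1 r : r \in rs -> 1 < `|r|.
  move=> rrs; rewrite real_ltNge ?real1 ?normr_real //; apply/negP => /nz.
  by rewrite -/(root q r) qE rootZ ?lead_coef_eq0 // root_prod_XsubC rrs.
exists (`|lead_coef q| * \prod_(r <- rs) (`|r| - 1)).
  rewrite mulr_gt0 ?normr_gt0 ?lead_coef_eq0 // // big_seq prodr_gt0 // => r /rs1.
  by rewrite subr_gt0.
move=> w w1; rewrite {2}qE hornerZ normrM ler_wpM2l // horner_prod normr_prod.
rewrite big_seq [leRHS]big_seq; apply: ler_prod => r /rs1 r1.
rewrite subr_ge0 ltW // hornerXsubC distrC (le_trans _ (lerB_dist _ _)) //.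
by rewrite lerD2l lerN2.
Qed.

(** A Harnack type bound, obtained root by root: for [1 < |r|] the distance [|x - r|] is at least
    [(1 - |x|) / 2] times [1 + |r|], hence times [|1 - r|]. There are at most [d] roots and the
    factor is at most 1. *)
Lemma disc_free_inner_bound d q x : (size q <= d.+1)%N -> disc_free q -> `|x| < 1 ->
  ((1 - `|x|) / 2) ^+ d * `|q.[1]| <= `|q.[x]|.
Proof.
move=> sq nz x1; have [rs qE] := closed_field_poly_normal q.
have q0 : q != 0 by apply/eqP => q0; have := nz 0; rewrite normr0 ler01 q0 horner0 eqxx => /(_ isT).
have rs1 r : r \in rs -> 1 < `|r|.
  move=> rrs; rewrite real_ltNge ?real1 ?normr_real //; apply/negP => /nz.
  by rewrite -/(root q r) qE rootZ ?lead_coef_eq0 // root_prod_XsubC rrs.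
set k := (1 - `|x|) / 2; have k0 : 0 <= k by rewrite divr_ge0 ?subr_ge0 ?ltW.
have k1 : k <= 1 by rewrite ler_pdivrMr // mul1r lerBlDr ler_wpDr // ler1n.
have srs : (size rs <= d)%N.
  by move: sq; rewrite qE size_scale ?lead_coef_eq0 // size_prod_XsubC.
apply: (@le_trans _ _ (k ^+ size rs * `|q.[1]|)); first by rewrite ler_wpM2r // ler_wiXn2l.
have nE z : `|q.[z]| = `|lead_coef q| * \prod_(r <- rs) `|z - r|.
  rewrite {1}qE hornerZ normrM horner_prod normr_prod.
  by congr (_ * _); apply: eq_bigr => r _; rewrite hornerXsubC.
rewrite !nE mulrCA ler_wpM2l //.
elim: rs rs1 {qE srs nE} => [|r rs IH] rs1; first by rewrite !big_nil mulr1.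
rewrite !big_cons exprS mulrACA; apply: ler_pM.
- exact: mulr_ge0.
- by apply: mulr_ge0; [apply: exprn_ge0|apply: prodr_ge0].
- have r1 : 1 < `|r| by apply: rs1; rewrite inE eqxx.
  apply: (@le_trans _ _ (`|r| - `|x|)); last by rewrite distrC lerB_dist.
  apply: (@le_trans _ _ (k * (1 + `|r|))).
    by rewrite ler_wpM2l // (le_trans (ler_normB _ _)) // normr1.
  rewrite mulrAC ler_pdivrMr // -subr_ge0.
  have -> : (`|r| - `|x|) * 2 - (1 - `|x|) * (1 + `|r|) = (`|r| - 1) * (1 + `|x|) by ring.
  by rewrite mulr_ge0 // ?subr_ge0 ?(ltW r1) // addr_ge0.
- by apply: IH => s srs; apply: rs1; rewrite inE srs orbT.
Qed.

Lemma small_radius m K : 0 < m -> 0 <= K -> exists e : C, [/\ 0 < e, e <= 1 & K * e < m].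
Proof.
move=> m0 K0; have s0 : 0 < m + K + 1 by rewrite ltr_wpDl // addr_ge0 // ltW.
exists (m / (m + K + 1)); split; first exact: divr_gt0.
  by rewrite ler_pdivrMr // mul1r -addrA lerDl addr_ge0.
by rewrite mulrA ltr_pdivrMr // mulrC ltr_pM2l // -addrA addrCA ltrDl addr_gt0.
Qed.

(** If the slice at [x] is zero-free, its lower bound survives small changes. Otherwise it has a
    zero [w0], strictly inside since the circle is excluded; a zero-free slice nearby would be small
    at [w0] but not at 1, against [disc_free_inner_bound]. *)
Lemma disc_free_locally_const d (F : nat -> {poly C}) a b :
  (forall z, a <= z <= b -> forall w, `|w| = 1 -> (slice d F z).[w] != 0) ->
  locally_const (fun z => disc_free (slice d F z)) a b.
Proof.
move=> nz x xab; have [K K0 HK] := slice_lipschitz d F x.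
have [nzx|] := classic (disc_free (slice d F x)).
  have [m m0 Hm] := disc_free_bound nzx; have [e [e0 e1 Ke]] := small_radius m0 K0.
  exists e => // y _ ye; split=> // _ w w1.
  have lt : `|(slice d F y).[w] - (slice d F x).[w]| < m.
    apply: le_lt_trans Ke; apply: le_trans (HK y _ w w1) _.
      by apply: le_trans e1; apply: ltW.
    by rewrite ler_wpM2l // ltW.
  apply: contraTneq lt => ->; rewrite sub0r normrN -real_leNgt ?normr_real ?gtr0_real //.
  exact: Hm.
move=> nnz; have [w0 [w1 qw]] : exists w0, `|w0| <= 1 /\ (slice d F x).[w0] = 0.
  apply: NNPP => H; apply: nnz => w w1; apply/eqP => qw; apply: H; by exists w.
have {}w1 : `|w0| < 1.
  rewrite lt_neqAle w1 andbT; apply: contra_eqN qw => /eqP; exact: nz.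
set M := `|(slice d F x).[1]|; have M0 : 0 < M by rewrite normr_gt0 nz // normr1.
set k := ((1 - `|w0|) / 2) ^+ d.
have b0 : 0 < (1 - `|w0|) / 2 by rewrite divr_gt0 // subr_gt0.
have k0 : 0 < k by rewrite exprn_gt0.
have k1 : k <= 1.
  by rewrite exprn_ile1 ?(ltW b0) // ler_pdivrMr // mul1r lerBlDr ler_wpDr // ler1n.
have [e [e0 e1 Ke]] := small_radius (mulr_gt0 k0 M0) (mulr_ge0 (ler0n _ 2) K0).
exists e => // y _ ye; split=> // nzy; exfalso.
have ye1 : `|y - x| <= 1 by apply: le_trans e1; apply: ltW.
have A1 := HK y ye1 w0 (ltW w1); rewrite qw subr0 in A1.
have A2 := HK y ye1 1; rewrite normr1 lexx in A2; have {}A2 := A2 isT.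
have A3 := disc_free_inner_bound (size_poly _ _) nzy w1; rewrite -/k in A3.
have A4 : M <= `|(slice d F y).[1]| + K * `|y - x|.
  rewrite -lerBlDl; apply: le_trans A2; rewrite distrC; exact: lerB_dist.
have : k * M <= 2 * K * e.
  apply: (@le_trans _ _ (k * `|(slice d F y).[1]| + k * (K * `|y - x|))).
    by rewrite -mulrDr ler_pM2l.
  have Ky : K * `|y - x| <= K * e by rewrite ler_wpM2l // ltW.
  rewrite -mulrA mulr_natl mulr2n lerD //; first by apply: le_trans A3 _; apply: le_trans A1 _.
  apply: le_trans Ky; rewrite ler_piMl // mulr_ge0 //.
by move=> /le_lt_trans/(_ Ke); rewrite ltxx.
Qed.

Lemma disc_free_persists d (F : nat -> {poly C}) a b :
  a \is Num.real -> b \is Num.real -> a <= b ->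
  (forall z, a <= z <= b -> forall w, `|w| = 1 -> (slice d F z).[w] != 0) ->
  disc_free (slice d F a) -> disc_free (slice d F b).
Proof.
move=> ar br ab nz; have [rs rsP] := disc_free_const_off d F.
suff [] : disc_free (slice d F a) <-> disc_free (slice d F b) by [].
apply: (@locally_const_const (fun z => disc_free (slice d F z)) rs) => //.
  move=> x y ax xy yb; have xr : x \is Num.real.
    by rewrite -[x](subrK a) rpredD // ger0_real // subr_ge0.
  by apply: rsP => //; rewrite -[y](subrK x) rpredD // ger0_real // subr_ge0.
exact: disc_free_locally_const.
Qed.
End Family.

(** * Directions outside the imaginary projection *)

Section Garding.
Variables (C : numClosedFieldType) (n : nat).
Implicit Types (p : ip C n) (x y e v : 'I_n -> C).

Definition homog d p := forall l z, ev (fun i => l * z i) p = l ^+ d * ev z p.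

(** For real [y] this says that [y] lies outside the imaginary projection, see
    [rcompl_imag_proj]. *)
Definition stable_dir p y := forall x, realvec x -> ev (fun i => x i + 'i * y i) p != 0.

Lemma homog_eq0 d p l z : homog d p -> l != 0 ->
  (ev (fun i => l * z i) p == 0) = (ev z p == 0).
Proof. by move=> H l0; rewrite H mulf_eq0 expf_eq0 (negPf l0) andbF. Qed.

(** The coordinates [s i] are polynomials in [w] whose coefficients are polynomials in the
    parameter; substituting them into [p] yields a family to which [disc_free_persists] applies. *)
Lemma disc_homotopy p (s : 'I_n -> {poly {poly C}}) (a b : C) :
  let pt (z w : C) i := (map_poly (horner_eval z) (s i)).[w] in
  a \is Num.real -> b \is Num.real -> a <= b ->
  (forall z : C, a <= z <= b -> forall w, `|w| = 1 -> ev (pt z w) p != 0) ->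
  (forall w, `|w| <= 1 -> ev (pt a w) p != 0) ->
  forall w, `|w| <= 1 -> ev (pt b w) p != 0.
Proof.
move=> pt ar br ab nz H.
pose phi : {rmorphism C -> {poly {poly C}}} := @polyC {poly C} \o @polyC C.
pose Q : {poly {poly C}} := sub phi s p.
have E z w : ev (pt z w) p = (slice (size Q) (fun i => Q`_i) z).[w].
  have -> : slice (size Q) (fun i => Q`_i) z = map_poly (horner_eval z) Q.
    apply/polyP => i; rewrite coef_poly coef_map /= /horner_eval.
    by case: ltnP => // lt; rewrite nth_default ?horner0 // ltnW.
  symmetry; apply: (sub_comp (psi := horner_eval w \o map_poly (horner_eval z))) => //= c.
  by rewrite map_polyC /= /horner_eval !hornerC.
move=> w w1; rewrite E.
apply: (@disc_free_persists _ _ _ a b) => // [z zab u u1|u u1]; first by rewrite -E nz.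
by rewrite -E H.
Qed.

Lemma stable_dirP d p e y c z : homog d p -> stable_dir p e -> realvec y -> c != 0 ->
  (forall i, z i = c * (y i + 'i * e i)) -> ev z p != 0.
Proof. by move=> H se ry c0 E; rewrite (eq_ev _ E) (homog_eq0 _ H c0) se. Qed.

Lemma stable_dir_neq0 d p e : homog d p -> stable_dir p e -> ev e p != 0.
Proof.
move=> H se; apply: (@stable_dirP d p e (fun=> 0) (- 'i)) => //.
- by rewrite oppr_eq0 neq0Ci.
- by move=> i; rewrite add0r mulrA mulNr -expr2 sqrCi opprK mul1r.
Qed.

(** For non-real [t] the point [v + t e] is ['Im t] times a real vector plus ['i e]. *)
Lemma stable_real_root d p e v t : homog d p -> stable_dir p e -> realvec e -> realvec v ->
  ev (fun i => v i + t * e i) p = 0 -> t \is Num.real.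
Proof.
move=> H se re rv; apply: contra_eqT => nr.
have b0 : 'Im t != 0.
  by apply: contra nr => /eqP b0; rewrite [t]Crect b0 mulr0 addr0 Creal_Re.
apply: (@stable_dirP d p e (fun i => ('Im t)^-1 * (v i + 'Re t * e i)) ('Im t)) => // i.
  by rewrite rpredM ?rpredV ?rpredD ?rpredM ?Creal_Re ?Creal_Im.
by rewrite [RHS]mulrDr [X in _ = X + _]mulrA divff // mul1r {1}[t]Crect; ring.
Qed.

(* [w] is the Cayley parameter of the half-plane.  The homotopy scales [x] by [z] in [[0, 1]]:
   on [|w| = 1] the point is a multiple of a real vector plus ['i e], and at [z = 0] only the
   real line through [v] with direction [e] is involved. *)
Lemma half_plane_disc d p e v x : homog d p -> stable_dir p e ->
  realvec e -> realvec v -> realvec x ->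
  (forall s : C, 0 <= s -> ev (fun i => v i + s * e i) p != 0) ->
  forall w : C, `|w| <= 1 ->
    ev (fun i => (1 - w) * (e i - 'i * x i) + (1 + w) * v i) p != 0.
Proof.
move=> H se re rv rx Hs w w1.
pose s i : {poly {poly C}} :=
  (1 - 'X) * ((e i)%:P - ('i * x i) *: 'X)%:P + (1 + 'X) * (v i)%:P%:P.
pose pt (z u : C) i := (1 - u) * (e i - z * ('i * x i)) + (1 + u) * v i.
have ptE z u : pt z u =1 (fun i => (map_poly (horner_eval z) (s i)).[u]).
  move=> i; rewrite /s !(rmorphD, rmorphN, rmorphM, rmorph1) /= map_polyX !map_polyC /=.
  by rewrite /horner_eval !hornerE /pt [z * _]mulrC.
have -> : ev (fun i => (1 - w) * (e i - 'i * x i) + (1 + w) * v i) p = ev (pt 1 w) p.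
  by apply: eq_ev => i; rewrite /pt mul1r.
have v0 : ev v p != 0.
  by have := Hs 0 (lexx _); rewrite (@eq_ev _ _ _ v) // => i; rewrite mul0r addr0.
rewrite (eq_ev _ (ptE _ _)).
apply: (@disc_homotopy p s 0 1) => // [z z01 u u1|u u1].
  rewrite -(eq_ev _ (ptE _ _)).
  have zr : z \is Num.real by case/andP: z01 => z0 _; rewrite ger0_real.
  have [u11|nu1] := eqVneq u 1.
    rewrite (@eq_ev _ _ _ (fun i => 2 * v i)) ?(homog_eq0 _ H) ?pnatr_eq0 //.
    by move=> i; rewrite /pt u11; ring.
  have u10 : 1 - u != 0 by rewrite subr_eq0 eq_sym.
  (* The quotient [(1 + u) / (1 - u)] is purely imaginary on the unit circle, which makes [k]
     real. *)
  pose k := - 'i * ((1 + u) / (1 - u)).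
  have kr : k \is Num.real.
    have uu : u * u^* = 1 by rewrite -normCK u1 expr1n.
    have u10' : 1 - u^* != 0.
      by rewrite -(rmorph1 Num.conj) -rmorphB fmorph_eq0.
    have ac : ((1 + u) / (1 - u))^* = - ((1 + u) / (1 - u)).
      rewrite fmorph_div rmorphD rmorphB rmorph1 /= -mulNr; apply/eqP; rewrite eqr_div //.
      have -> : (1 + u^*) * (1 - u) = (u^* - u) + (1 - u * u^*) by ring.
      have -> : - (1 + u) * (1 - u^*) = (u^* - u) - (1 - u * u^*) by ring.
      by rewrite uu subrr subr0 addr0.
    by apply/CrealP; rewrite /k rmorphM rmorphN /= conjCi ac; ring.
  apply: (@stable_dirP d p e (fun i => z * x i - k * v i) (- 'i * (1 - u))) => // [i||i].
  - by apply: rpredB; [apply: (rpredM zr (rx i))|apply: (rpredM kr (rv i))].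
  - by rewrite mulf_neq0 // oppr_eq0 neq0Ci.
  rewrite /pt /k.
  have -> : - 'i * (1 - u) * (z * x i - - 'i * ((1 + u) / (1 - u)) * v i + 'i * e i) =
     (- ('i * 'i)) * ((1 - u) * e i + (1 + u) / (1 - u) * (1 - u) * v i) - 'i * (1 - u) * z * x i by ring.
  by rewrite divfK // -expr2 sqrCi opprK; ring.
rewrite -(eq_ev _ (ptE _ _)); apply/eqP => E.
have [u1E|u10] := eqVneq (1 + u) 0.
  have : ev (pt 0 u) p == 0 by rewrite E.
  rewrite (@eq_ev _ _ _ (fun i => 2 * e i)) => [|i].
    by rewrite (homog_eq0 _ H) ?pnatr_eq0 // (negPf (stable_dir_neq0 H se)).
  have -> : u = -1 by rewrite -[u](addKr 1) u1E addr0.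
  by rewrite /pt; ring.
(* At parameter 0 the point is [(1 + u) (v + t e)]. A zero makes [t] real, and then
   [t |1 + u|^2 = 1 - |u|^2] makes it nonnegative, against the hypothesis on the ray. *)
pose t := (1 - u) / (1 + u); have E1 : t * (1 + u) = 1 - u by rewrite divfK.
have Et : ev (fun i => v i + t * e i) p = 0.
  apply/eqP; rewrite -(homog_eq0 _ H u10); apply/eqP; rewrite -[RHS]E.
  apply: eq_ev => i; rewrite /pt.
  have -> : (1 + u) * (v i + t * e i) = (t * (1 + u)) * e i + (1 + u) * v i by ring.
  by rewrite E1; ring.
have tr := stable_real_root H se re rv Et.
suff t0 : 0 <= t by have := Hs t t0; rewrite Et eqxx.
have n0 : 0 < `|1 + u| ^+ 2 by rewrite exprn_gt0 // normr_gt0.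
rewrite -(pmulr_lge0 _ n0) -(pmulr_lge0 _ (ltr0n _ 2 : 0 < 2)).
have E2 : t * (1 + u^*) = 1 - u^*.
  by rewrite -{1}(CrealP tr) -(rmorph1 Num.conj) -rmorphD -rmorphM E1 rmorphB.
have -> : t * `|1 + u| ^+ 2 * 2 = 2 * (1 - `|u| ^+ 2).
  rewrite !normCK rmorphD rmorph1 /=.
  have -> : t * ((1 + u) * (1 + u^*)) * 2 =
    (t * (1 + u)) * (1 + u^*) + (t * (1 + u^*)) * (1 + u) by ring.
  by rewrite E1 E2; ring.
by rewrite mulr_ge0 // subr_ge0 exprn_ile1.
Qed.

Lemma poly_neq0_near (q : {poly C}) a : q.[a] != 0 ->
  exists2 e : C, 0 < e & forall y : C, `|y - a| <= e -> q.[y] != 0.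
Proof.
rewrite -normr_gt0 => m0; have [K K0 HK] := poly_lipschitz q a.
have [e [e0 e1 Ke]] := small_radius m0 K0; exists e => // y ye.
have KeR : K * e \is Num.real by rewrite ger0_real // mulr_ge0 // ltW.
apply: contraTneq Ke => qy; rewrite -real_leNgt ?normr_real ?KeR //.
have := HK y (le_trans ye e1); rewrite qy sub0r normrN => /le_trans; apply.
by rewrite ler_wpM2l.
Qed.

Definition line_poly m (p : ip C m) (v e : 'I_m -> C) : {poly C} :=
  sub (@polyC C) (fun i => (v i)%:P + e i *: 'X) p.

Lemma line_polyE m (p : ip C m) (v e : 'I_m -> C) t : (line_poly p v e).[t] = ev (fun i => v i + t * e i) p.
Proof.
apply: (sub_comp (psi := horner_eval t)) => [c|i]; rewrite /= /horner_eval !hornerE //.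
by rewrite mulrC.
Qed.

(* Moving [v] slightly back along [e] makes the point [x + 'i v] an interior point of the disc. *)
Lemma garding d p e v : homog d p -> stable_dir p e -> realvec e -> realvec v ->
  (forall s : C, 0 <= s -> ev (fun i => v i + s * e i) p != 0) -> stable_dir p v.
Proof.
move=> H se re rv Hs x rx.
have [|h h0 Hh] := @poly_neq0_near (line_poly p v e) 0.
  by rewrite line_polyE Hs.
have hr : h \is Num.real by rewrite gtr0_real.
have h1 : 0 < 1 + h by rewrite addr_gt0.
have h10 := lt0r_neq0 h1; have hn0 := lt0r_neq0 h0.
(* This [w] solves [(1 - w) / (1 + w) = h]; with [v - h e] and [x / h] the point of
   [half_plane_disc] becomes a multiple of [x + 'i v]. *)
pose w := (1 - h) / (1 + h).
have w1 : `|w| <= 1.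
  rewrite normrM normfV (gtr0_norm h1) ler_pdivrMr // mul1r.
  by rewrite (le_trans (ler_normB _ _)) // normr1 gtr0_norm.
have rv' : realvec (fun i => v i - h * e i) by move=> i; rewrite rpredB ?rpredM.
have rx' : realvec (fun i => h^-1 * x i) by move=> i; rewrite rpredM ?rpredV.
have := half_plane_disc H se re rv' rx' _ w1.
rewrite (@eq_ev _ _ _ (fun i => (- 'i * (2 / (1 + h))) * (x i + 'i * v i))) => [|i].
  rewrite (homog_eq0 _ H) ?mulf_neq0 ?oppr_eq0 ?neq0Ci ?invr_eq0 ?pnatr_eq0 //; apply=> s s0.
  have sr : s \is Num.real by rewrite ger0_real.
  rewrite (@eq_ev _ _ _ (fun i => v i + (s - h) * e i)) => [|i]; last by ring.
  have [hs|sh] := real_leP hr sr; first by rewrite Hs // subr_ge0.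
  rewrite -line_polyE Hh // subr0 distrC gtr0_norm ?subr_gt0 //.
  by rewrite gerBl.
have ii : 'i * 'i = -1 :> C by rewrite -expr2 sqrCi.
have E1 : 1 - w = 2 / (1 + h) * h.
  by apply: (mulIf h10); rewrite mulrBl mul1r divfK // mulrAC divfK //; ring.
have E2 : 1 + w = 2 / (1 + h).
  by apply: (mulIf h10); rewrite mulrDl mul1r !divfK //; ring.
rewrite E1 E2; set k := 2 / (1 + h).
have -> : - 'i * k * (x i + 'i * v i) = - ('i * 'i) * k * v i - k * 'i * x i by ring.
rewrite ii opprK mul1r.
have -> : k * h * (e i - 'i * (h^-1 * x i)) = k * h * e i - k * 'i * (h * h^-1) * x i by ring.
by rewrite divff //; ring.
Qed.

(** Up to the factor [1 + s], the ray point [v + s y] is the segment point with parameter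
    [s / (1 + s)]. *)
Lemma stable_segment d p y v : homog d p -> stable_dir p y -> realvec y -> realvec v ->
  (forall t : C, 0 <= t <= 1 -> ev (fun i => (1 - t) * v i + t * y i) p != 0) -> stable_dir p v.
Proof.
move=> H sy ry rv Ht; apply: (garding H sy ry rv) => s s0.
have s1 : 0 < 1 + s by rewrite ltr_wpDr.
have s10 := lt0r_neq0 s1.
rewrite (@eq_ev _ _ _ (fun i => (1 + s) * ((1 - s / (1 + s)) * v i + s / (1 + s) * y i))).
  rewrite (homog_eq0 _ H) // Ht // divr_ge0 ?(ltW s1) //= ler_pdivrMr // mul1r.
  by rewrite lerDr.
move=> i; have -> : (1 + s) * ((1 - s / (1 + s)) * v i + s / (1 + s) * y i) =
  (1 + s) * v i - (s / (1 + s) * (1 + s)) * v i + s / (1 + s) * (1 + s) * y i by ring.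
by rewrite divfK //; ring.
Qed.

Lemma ev_lipschitz m (p : ip C m) (w : 'I_m -> C) : exists2 K : C, 0 <= K &
  forall r z, 0 <= r -> r <= 1 -> (forall i, `|z i - w i| <= r) ->
  `|ev z p - ev w p| <= K * r.
Proof.
move: p; apply: ip_ind => [c|i|p q [K K0 HK] [L L0 HL]|p q [K K0 HK] [L L0 HL]].
- by exists 0 => // r z _ _ _; rewrite !ev_C subrr normr0 mul0r.
- by exists 1 => // r z _ _ H; rewrite !ev_var mul1r.
- exists (K + L) => [|r z r0 r1 H]; first exact: addr_ge0.
  rewrite !rmorphD opprD addrACA mulrDl (le_trans (ler_normD _ _)) //.
  by rewrite lerD ?HK ?HL.
exists (K * (`|ev w q| + L) + `|ev w p| * L) => [|r z r0 r1 H].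
  by rewrite addr_ge0 ?mulr_ge0 ?addr_ge0.
have HKr := HK r z r0 r1 H; have HLr := HL r z r0 r1 H.
rewrite !rmorphM.
have -> : ev z p * ev z q - ev w p * ev w q =
  (ev z p - ev w p) * ev z q + ev w p * (ev z q - ev w q) by ring.
rewrite [leRHS]mulrDl (le_trans (ler_normD _ _)) // !normrM lerD //; last first.
  by rewrite -mulrA ler_wpM2l.
rewrite mulrAC ler_pM // -[ev z q](subrK (ev w q)) addrC (le_trans (ler_normD _ _)) //.
by rewrite lerD2l (le_trans HLr) // ler_piMr.
Qed.

Lemma ev_neq0_near m (p : ip C m) (w : 'I_m -> C) : ev w p != 0 ->
  exists2 e : C, 0 < e & forall z, (forall i, `|z i - w i| <= e) -> ev z p != 0.
Proof.
rewrite -normr_gt0 => m0; have [K K0 HK] := ev_lipschitz p w.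
have [e [e0 e1 Ke]] := small_radius m0 K0; exists e => // z ze.
have KeR : K * e \is Num.real by rewrite ger0_real // mulr_ge0 // ltW.
apply: contraTneq Ke => qz; rewrite -real_leNgt ?normr_real ?KeR //.
by have := HK e z (ltW e0) e1 ze; rewrite qz sub0r normrN.
Qed.

(* The ball is convex, so every segment in it joins points where [p] does not vanish. *)
Lemma stable_near d p w : homog d p -> realvec w -> ev w p != 0 ->
  exists2 e : C, 0 < e & forall y z, realvec y -> realvec z ->
    (forall i, `|y i - w i| <= e) -> (forall i, `|z i - w i| <= e) ->
    stable_dir p y -> stable_dir p z.
Proof.
move=> H rw w0; have [e e0 He] := ev_neq0_near w0; exists e => // y z ry rz ye ze sy.
apply: (stable_segment H sy) => // t /andP[t0 t1]; apply: He => i.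
have -> : (1 - t) * z i + t * y i - w i = (1 - t) * (z i - w i) + t * (y i - w i) by ring.
have t1' : 0 <= 1 - t by rewrite subr_ge0.
rewrite (le_trans (ler_normD _ _)) // !normrM (ger0_norm t0) (ger0_norm t1').
have -> : e = (1 - t) * e + t * e by ring.
by apply: lerD; apply: ler_wpM2l.
Qed.

End Garding.

(** * Shears and transfer of irreducibility *)

Section Shear.
Variables (C : numClosedFieldType) (n : nat).
Implicit Types (a w : 'I_n -> C) (z : 'I_n.+1 -> C).

(** A linear change of coordinates taking the first axis to the direction [pcons 1 a]: moving along
    that direction becomes moving variable 0 alone. *)
Definition shear a z : 'I_n.+1 -> C :=
  pcons (z ord0) (fun j => z (lift ord0 j) + z ord0 * a j).

Definition shear_ip a (p : ip C n.+1) : ip C n.+1 :=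
  sub (ipC C n.+1) (fun i => if unlift ord0 i is Some j
    then ipvar C (lift ord0 j) + ipvar C ord0 * ipC C n.+1 (a j) else ipvar C ord0) p.

Lemma ev_shear a p z : ev z (shear_ip a p) = ev (shear a z) p.
Proof.
rewrite /shear_ip ev_sub; apply: eq_ev => i; rewrite /shear /pcons.
by case: (unliftP ord0 i) => [j|] _; rewrite ?rmorphD ?rmorphM !ev_var ?ev_C.
Qed.

Lemma shearK a z : shear a (shear (fun j => - a j) z) =1 z.
Proof.
move=> i; rewrite /shear /pcons; case: (unliftP ord0 i) => [j|] -> //.
  by rewrite liftK unlift_none; ring.
by rewrite unlift_none.
Qed.

Lemma shearNK a z : shear (fun j => - a j) (shear a z) =1 z.
Proof.
move=> i; rewrite /shear /pcons; case: (unliftP ord0 i) => [j|] -> //.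
  by rewrite liftK unlift_none; ring.
by rewrite unlift_none.
Qed.

Lemma ev_unshear a p z : ev z p = ev (shear (fun j => - a j) z) (shear_ip a p).
Proof. by rewrite ev_shear; apply: eq_ev => i; rewrite shearK. Qed.

Lemma shear_pcons a t w : shear a (pcons t w) =1 (fun i => pcons 0 w i + t * pcons 1 a i).
Proof.
move=> i; rewrite /shear /pcons; case: (unliftP ord0 i) => [j|] _.
  by rewrite liftK unlift_none.
by rewrite unlift_none add0r mulr1.
Qed.
End Shear.

Lemma unit_ipC (C : numClosedFieldType) n (p : ip C n) :
  p \is a GRing.unit -> exists c, p = ipC C n c.
Proof.
elim: n p => [|n IH] p; first by exists p.
move=> up; have : (p : {poly ip C n}) \is a GRing.unit by [].
rewrite poly_unitE => /andP[/eqP s1 /IH[c pE]].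
by exists c; rewrite /= -pE; apply: size1_polyC; rewrite s1.
Qed.

(** A shear is an automorphism, so factors can be sheared back and irreducibility carries over; in a
    factorial ring it implies primality. *)
Lemma shear_prime (C : numClosedFieldType) n a (f : mpoly C n.+1) :
  mp_irreducible f -> prime_elt (shear_ip a (toip f)).
Proof.
move=> [nc irr]; set F := shear_ip a (toip f).
have cst c : F = ipC C n.+1 c -> False.
  move=> FE; apply: nc; apply/mp_constant_toip; exists c; apply: ev_inj => z.
  by rewrite (ev_unshear a) -/F FE !ev_C.
have F0 : F != 0 by apply/eqP => F0; apply: (cst 0); rewrite rmorph0.
apply: factored_irreducible_prime; first exact: ufd_ip.
  by apply/negP => /unit_ipC[c /cst].
move=> P Q FE.
have back (q : mpoly C n.+1) R : R != 0 -> toip q = shear_ip (fun j => - a j) R -> mp_constant q ->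
    R \is a GRing.unit.
  move=> R0 qE /mp_constant_toip[c cE].
  have RE : R = ipC C n.+1 c.
    apply: ev_inj => z; rewrite ev_C -[RHS](ev_C (shear a z)) -cE qE ev_shear.
    by apply: eq_ev => i; rewrite shearNK.
  rewrite RE rmorph_unit // unitfE; apply: contraNneq R0 => c0.
  by rewrite RE c0 rmorph0.
have := F0; rewrite FE mulf_eq0 negb_or => /andP[P0 Q0].
have [q qE] := toip_surj (shear_ip (fun j => - a j) P).
have [r rE] := toip_surj (shear_ip (fun j => - a j) Q).
have : mpeq f (mpmul q r).
  apply/mpeqP; rewrite toip_mul qE rE; apply: ev_inj => z.
  by rewrite rmorphM !ev_shear -rmorphM -FE -ev_unshear.
by case/irr => [/(back _ _ P0 qE)|/(back _ _ Q0 rE)]; [left|right].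
Qed.

(** By homogeneity a constant restriction gives [p(e + s x) = c s^d] for all [s != 0], hence also at
    [s = 0], where it reads [p(e) = 0]. *)
Lemma line_nonconst (C : numClosedFieldType) n d (p : ip C n) (x e : 'I_n -> C) c :
  homog d p -> (0 < d)%N \/ c = 0 -> ev e p != 0 ->
  ~ (forall t, ev (fun i => x i + t * e i) p = c).
Proof.
move=> hom dc e0 H; pose M := line_poly p e x - c *: 'X^d.
have : M * 'X = 0.
  apply: poly_real_roots_eq0 => s _; rewrite hornerMX.
  have [->|s0] := eqVneq s 0; first by rewrite mulr0.
  rewrite hornerD hornerN hornerZ hornerXn line_polyE.
  rewrite (@eq_ev _ _ _ (fun i => s * (x i + s^-1 * e i))) ?hom ?H => [|i].
    by rewrite mulrC [s ^+ d * _]mulrC subrr mulr0.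
  by rewrite mulrDr mulrA divff // mul1r addrC.
move=> /eqP; rewrite mulf_eq0 polyX_eq0 orbF => /eqP M0.
have := line_polyE p e x 0; rewrite -[line_poly _ _ _](subrK (c *: 'X^d)) -/M M0 add0r.
rewrite hornerZ hornerXn expr0n.
have -> : c * (d == 0)%:R = 0 by case: dc => [d0|->]; rewrite ?mul0r // gtn_eqF // mulr0.
rewrite (@eq_ev _ _ _ e) => [/esym/eqP|i]; first by apply/negP.
by rewrite mul0r addr0.
Qed.

(** * The boundary of the complement and its Zariski closure *)

Section Boundary.
Variables (C : numClosedFieldType) (n : nat) (f : mpoly C n) (d : nat).
Hypothesis hom : homog d (toip f).

Lemma rcompl_imag_proj (y : 'I_n -> C) : rcompl (imag_proj f) y <-> realvec y /\ stable_dir (toip f) y.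
Proof.
split=> [[ry nI]|[ry sy]]; split=> //.
  move=> x rx; apply/eqP => E; apply: nI; split=> //.
  by exists (fun i => x i + 'i * y i); rewrite -ev_toip; split=> // i; rewrite Im_rect.
case=> _ [z [fz yE]]; have rx : realvec (fun i => 'Re (z i)) by move=> i; exact: Creal_Re.
have := sy _ rx; rewrite (@eq_ev _ _ _ z) ?ev_toip ?fz ?eqxx // => i.
by rewrite yE -Crect.
Qed.

Lemma real_zero_imag_proj (x : 'I_n -> C) : real_zero_set f x -> imag_proj f x.
Proof.
case=> rx fx; split=> //; exists (fun i => 'i * x i); split.
  by rewrite -ev_toip hom ev_toip fx mulr0.
by move=> i; rewrite -['i * x i]add0r Im_rect.
Qed.

(** Near a point where [f] does not vanish, [stable_near] puts either all real points or none in the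
    complement. *)
Lemma boundary_zero (w : 'I_n -> C) : rboundary (rcompl (imag_proj f)) w -> meval f w = 0.
Proof.
case=> [[rw H1] [_ H2]]; rewrite -ev_toip; apply/eqP; apply: contraT => w0.
have [e e0 He] := stable_near hom rw w0.
have [y [/rcompl_imag_proj[ry sy] ye]] := H1 e e0.
have [z [[rz nz] ze]] := H2 e e0.
case: nz; apply/rcompl_imag_proj; split=> //; apply: (He y) => // i; rewrite distrC ltW //.
Qed.

Lemma max_real (s : seq C) x : x \in s -> (forall y, y \in s -> y \is Num.real) ->
  exists2 m, m \in s & forall y, y \in s -> y <= m.
Proof.
elim: s x => // r s IH x _ sr.
have rr : r \is Num.real by apply: sr; rewrite inE eqxx.
case: s IH sr => [|r' s] IH sr; first by exists r => [|y]; rewrite ?inE // => /eqP->.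
have [|y ys|m ms mP] := IH r'; first by rewrite inE eqxx.
  by apply: sr; rewrite inE ys orbT.
have mr : m \is Num.real by apply: sr; rewrite inE ms orbT.
have [rm|mr'] := real_leP rr mr.
  by exists m => [|y]; rewrite inE ?ms ?orbT // => /orP[/eqP->|/mP].
exists r => [|y]; rewrite inE ?eqxx // => /orP[/eqP->//|/mP ym].
by apply: le_trans ym _; apply: ltW.
Qed.

(** The largest root [m] on the line works: its point is a real zero, hence in the imaginary
    projection, and any point further along [e] starts a zero-free ray, so [garding] puts it in the
    complement. *)
Lemma boundary_on_line (x e : 'I_n -> C) : (0 < d)%N -> realvec x -> realvec e ->
  stable_dir (toip f) e ->
  exists t, rboundary (rcompl (imag_proj f)) (fun i => x i + t * e i).
Proof.
move=> d0 rx re se; have e0 := stable_dir_neq0 hom se.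
pose L := line_poly (toip f) x e.
have LE t : L.[t] = ev (fun i => x i + t * e i) (toip f) by apply: line_polyE.
have L1 : (1 < size L)%N.
  rewrite ltnNge; apply/negP => s1; apply: (line_nonconst (x := x) (c := L`_0) hom _ e0) => [|t]; first by left.
  by rewrite -LE (size1_polyC s1) hornerC coefC.
have L0 : L != 0 by rewrite -size_poly_gt0 ltnW.
have /closed_rootP[r rr] : (size L != 1)%N by rewrite neq_ltn L1 orbT.
have [rs rsP] := poly_rootsP L0.
have [||m] := @max_real [seq t <- rs | root L t] r.
- by rewrite mem_filter rr rsP.
- move=> t; rewrite mem_filter => /andP[/rootP Lt _].
  by apply: (stable_real_root hom se re rx); rewrite -LE.
rewrite mem_filter => /andP[/rootP Lm _] mP.
have mr : m \is Num.real by apply: (stable_real_root hom se re rx); rewrite -LE.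
pose b i := x i + m * e i.
have rb : realvec b by move=> i; rewrite rpredD ?rpredM.
have fb : meval f b = 0 by rewrite -ev_toip -LE.
exists m; split; split=> // eps eps0; last first.
  exists b; split=> [|i]; last by rewrite subrr normr0.
  split=> // -[_]; apply; exact: real_zero_imag_proj.
(* [S] exceeds the modulus of every [e i], so a step [eps / S] along [e] moves each coordinate by
   less than [eps]. *)
pose S := 1 + \sum_(i < n) `|e i|.
have S0 : 0 < S by rewrite ltr_wpDr // sumr_ge0.
pose h := eps / S; have h0 : 0 < h by rewrite divr_gt0.
exists (fun i => b i + h * e i); split=> [|i].
  have rv : realvec (fun i => b i + h * e i).
    by move=> i; apply: (rpredD (rb i)); apply: rpredM (re i); apply: gtr0_real.
  apply/rcompl_imag_proj; split=> //; apply: (garding hom se) => // s s0.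
  rewrite (@eq_ev _ _ _ (fun i => x i + (m + (h + s)) * e i)) => [|i]; last by rewrite /b; ring.
  rewrite -LE; apply/negP => Lr.
  have : m + (h + s) <= m by apply: mP; rewrite mem_filter /root Lr rsP.
  by rewrite gerDl lt_geF // ltr_wpDr.
rewrite -/(b i) opprD addrA subrr add0r normrN normrM gtr0_norm // mulrAC ltr_pdivrMr //.
rewrite ltr_pM2l // /S (bigD1 i) //= addrCA ltrDl ltr_wpDr // sumr_ge0 //.
Qed.
End Boundary.

(** If the first coordinate is zero, openness of the complement near [e] permits making it nonzero;
    then rescale. *)
Lemma stable_dir_normalize (C : numClosedFieldType) n d (p : ip C n.+1) e : homog d p ->
  realvec e -> stable_dir p e ->
  exists2 a, realvec a & stable_dir p (pcons 1 a).
Proof.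
move=> hom re se.
have [e' [re' se' e0]] : exists e', [/\ realvec e', stable_dir p e' & e' ord0 != 0].
  have [e0|e0] := eqVneq (e ord0) 0; last by exists e.
  have [h h0 Hh] := stable_near hom re (stable_dir_neq0 hom se).
  have hr : h \is Num.real by rewrite gtr0_real.
  exists (pcons h (fun j => e (lift ord0 j))); split; last by rewrite pcons0 lt0r_neq0.
    by move=> i; rewrite /pcons; case: unlift.
  apply: (Hh e) => // i; rewrite ?subrr ?normr0 ?(ltW h0) //.
    by rewrite /pcons; case: unlift.
  rewrite /pcons; case: (unliftP ord0 i) => [j|] ->; first by rewrite subrr normr0 ltW.
  by rewrite e0 subr0 gtr0_norm.
exists (fun j => (e' ord0)^-1 * e' (lift ord0 j)) => [j|x rx]; first by rewrite rpredM ?rpredV.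
apply: (stable_dirP (y := fun i => e' ord0 * x i) (c := (e' ord0)^-1) hom se') => [i||i].
- by rewrite rpredM.
- by rewrite invr_eq0.
rewrite mulrDr mulrA mulVf // mul1r; congr (_ + _); rewrite mulrCA; congr (_ * _).
by rewrite /pcons; case: (unliftP ord0 i) => [j|] -> //; rewrite mulVf.
Qed.

Lemma zariski_boundary (C : numClosedFieldType) n (f : mpoly C n) :
  mp_nonzero f -> hyperbolic f -> mp_irreducible f ->
  forall z, zariski_closure (rboundary (rcompl (imag_proj f))) z <-> zero_set f z.
Proof.
move=> f0 [[d hd] [e [re [_ he]]]] irr z.
have hom : homog d (toip f) by move=> l w; rewrite !ev_toip (meval_homogeneous hd).
split=> [Hz|fz g Hg]; first by apply: Hz => w; apply: boundary_zero hom _.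
(* A zero at [x + 'i e] would be the non-real root ['i] on the line through [x]. *)
have se : stable_dir (toip f) e.
  move=> x rx; apply/eqP; rewrite ev_toip => E; have := he x rx 'i E.
  by move/CrealP/eqP; rewrite conjCi eq_sym -addr_eq0 -mulr2n mulrn_eq0 (negPf (neq0Ci _)).
have d0 : (0 < d)%N.
  rewrite lt0n; apply/eqP => d0; case: irr => nc _; apply: nc => m; rewrite -d0; exact: hd.
case: n => [|n] in f f0 hd e re he irr z hom fz g Hg se *.
  case: irr => nc _; case: nc => m _; exact: big_ord0.
have [a ra sa] := stable_dir_normalize hom re se.
have rea : realvec (pcons 1 a) by move=> i; rewrite /pcons; case: unlift => // _; rewrite real1.
pose P : {poly ip C n} := shear_ip a (toip f).
pose G : {poly ip C n} := shear_ip a (toip g).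
have [[Q GE]|ndiv] := classic (divides P G).
  rewrite -ev_toip (ev_unshear a) -/G GE (rmorphM (ev _)) /= [X in _ * X]ev_shear.
  by rewrite (eq_ev _ (shearK _ _)) ev_toip fz mulr0.
have sP : (1 < size P)%N.
  rewrite ltnNge; apply/negP => s1.
  apply: (line_nonconst (x := fun=> 0) (c := ev (fun=> 0) P`_0) hom _ (stable_dir_neq0 hom sa)).
    by left.
  move=> t; have := ev_shear a (toip f) (pcons t (fun=> 0)).
  rewrite (eq_ev _ (shear_pcons _ _ _)) ev_pcons -/P {1}(size1_polyC s1) map_polyC hornerC => ->.
  by apply: eq_ev => i; rewrite /pcons; case: unlift.
(* [c] involves only the remaining variables. Over a real [w] with [c(w) != 0] the line in direction
   [pcons 1 a] carries a boundary point, where [f] and [g], hence [c], would vanish. *)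
have [c [u [v [c0 cE]]]] := elimination (shear_prime a irr) sP ndiv.
have [w rw cw] := ev_real_neq0 c0.
have rx : realvec (pcons 0 w) by move=> i; rewrite /pcons; case: unlift => // _; rewrite real0.
have [t bt] := boundary_on_line hom d0 rx rea sa.
have ft := boundary_zero hom bt; have gt := Hg _ bt.
have : ev (pcons t w) (c%:P : ip C n.+1) = 0.
  rewrite cE (rmorphD (ev _)) !(rmorphM (ev _)) /= !ev_shear.
  by rewrite !(eq_ev _ (shear_pcons _ _ _)) !ev_toip ft gt !mulr0 addr0.
by rewrite ev_pcons map_polyC hornerC /= => /eqP; rewrite (negPf cw).
Qed.

(** * Real linear factors *)

Section Gradient.
Variables (C : numClosedFieldType).

(** The derivative at [Y] along [X], read off from a line so that it vanishes as soon as [p]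
    vanishes on that line. *)
Definition dir_deriv n (p : ip C n) (Y X : 'I_n -> C) : C := (line_poly p Y X)^`().[0].

Definition unitv n (i : 'I_n) : 'I_n -> C := fun k => (k == i)%:R.

(** A gradient is built by induction on [p] with the Leibniz rule, then identified by testing on
    unit vectors. *)
Lemma dir_deriv_linear n (p : ip C n) Y X :
  dir_deriv p Y X = \sum_(i < n) X i * dir_deriv p Y (unitv i).
Proof.
have [G GE] : exists G : 'I_n -> C, forall X, dir_deriv p Y X = \sum_(i < n) X i * G i.
  move: p; apply: ip_ind => [c|i|p q [G GE] [H HE]|p q [G GE] [H HE]].
  - exists (fun=> 0) => Z; rewrite /dir_deriv /line_poly sub_C derivC horner0.
    by rewrite big1 // => j _; rewrite mulr0.
  - exists (unitv i) => Z; rewrite /dir_deriv /line_poly sub_var !derivE !hornerE.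
    rewrite (bigD1 i) //= /unitv eqxx mulr1 big1 ?addr0 // => j ji.
    by rewrite (negPf ji) mulr0.
  - exists (fun i => G i + H i) => Z; rewrite /dir_deriv /line_poly rmorphD derivD hornerD.
    have := GE Z; rewrite /dir_deriv /line_poly => ->.
    have := HE Z; rewrite /dir_deriv /line_poly => ->.
    by rewrite -big_split; apply: eq_bigr => j _; rewrite mulrDr.
  exists (fun i => G i * ev Y q + ev Y p * H i) => Z.
  rewrite /dir_deriv /line_poly rmorphM derivM hornerD !hornerM.
  have L0 r : (line_poly r Y Z).[0] = ev Y r.
    by rewrite line_polyE; apply: eq_ev => j; rewrite mul0r addr0.
  have := GE Z; rewrite /dir_deriv /line_poly => ->.
  have := HE Z; rewrite /dir_deriv /line_poly => ->.
  rewrite -!/(line_poly _ _ _) !L0 mulr_suml mulr_sumr -big_split; apply: eq_bigr => j _ /=; ring.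
have Gi i : dir_deriv p Y (unitv i) = G i.
  rewrite GE (bigD1 i) //= /unitv eqxx mul1r big1 ?addr0 // => j ji.
  by rewrite (negPf ji) mul0r.
by rewrite GE; apply: eq_bigr => i _; rewrite Gi.
Qed.

Lemma dir_deriv0 n (P : {poly ip C n}) r y :
  dir_deriv (P : ip C n.+1) (pcons r y) (unitv ord0) = ev (pcons r y) (P^`() : ip C n.+1).
Proof.
have E : line_poly (P : ip C n.+1) (pcons r y) (unitv ord0) = map_poly (ev y) P \Po ('X + r%:P).
  apply/eqP; rewrite -subr_eq0; apply/eqP/poly_real_roots_eq0 => t _.
  rewrite hornerD hornerN horner_comp line_polyE !hornerE -ev_pcons.
  apply/eqP; rewrite subr_eq0; apply/eqP/eq_ev => i.
  by rewrite /pcons /unitv; case: (unliftP ord0 i) => [j|] -> /=; rewrite ?mulr0 ?addr0 // mulr1 addrC.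
rewrite /dir_deriv E deriv_comp !derivE addr0 mulr1 horner_comp !hornerE.
by rewrite deriv_map -ev_pcons.
Qed.
End Gradient.

Lemma max_power (A : idomainType) (P F : {poly A}) : (1 < size P)%N -> F != 0 ->
  exists k g, F = P ^+ k * g /\ ~ divides P g.
Proof.
move=> sP; have [m] := ubnP (size F); elim: m => // m IH in F *; rewrite ltnS => sF F0.
have [[G FE]|nd] := classic (divides P F); last by exists 0%N, F; rewrite expr0 mul1r.
have := F0; rewrite FE mulf_eq0 negb_or => /andP[G0 P0].
have sG : (size G < m)%N.
  apply: leq_trans sF; rewrite FE size_mul //.
  by case: (size P) sP => [|[|j]] // _; rewrite !addnS /= ltnS leq_addr.
have [k [g [GE nd]]] := IH G sG G0.
by exists k.+1, g; split=> //; rewrite GE exprSr mulrAC.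
Qed.

(** In characteristic 0 the derivative is nonzero, and it is shorter than [P]. *)
Lemma not_divides_deriv (C : numClosedFieldType) n (P : {poly ip C n}) :
  (1 < size P)%N -> ~ divides P P^`().
Proof.
move=> sP [Q QE]; have P0 : P != 0 by rewrite -size_poly_gt0 ltnW.
have D0 : P^`() != 0.
  apply/eqP => D0; have := congr1 (fun q : {poly ip C n} => q`_(size P).-2) D0.
  rewrite coef0 coef_deriv => /eqP; have -> : ((size P).-2).+1 = (size P).-1 by case: (size P) sP => [|[|]].
  rewrite -mulr_natr mulf_eq0 -lead_coefE lead_coef_eq0 (negPf P0) /=.
  rewrite -(rmorph_nat (ipC C n)) fmorph_eq0 pnatr_eq0.
  by case: (size P) sP => [|[|]].
have := D0; rewrite QE mulf_eq0 negb_or => /andP[Q0 _].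
have := lt_size_deriv P0; rewrite QE size_mul //.
have : (0 < size Q)%N by rewrite size_poly_gt0.
by case: (size Q) => // i _; rewrite addSn /= ltnNge leq_addl.
Qed.

(** Any complex scalar [c] is allowed here, so that the property passes to factors and products. *)
Definition real_split (C : numClosedFieldType) n (p : ip C n) :=
  exists c (ls : seq (mpoly C n)), (forall l, l \in ls -> real_linear l) /\
    forall z, ev z p = c * \prod_(l <- ls) meval l z.

Section RealSplit.
Variables (C : numClosedFieldType) (n d : nat) (F : ip C n.+1).
Hypothesis hom : homog d F.
Hypothesis Fe : ev (pcons 1 (fun=> 0)) F != 0.
Hypothesis HF : forall z, ev z F = 0 -> ev (fun i => 'Im (z i)) F = 0.

(** The imaginary part of [(b + 'i a) z] is [a 'Re z + b 'Im z], so [F] vanishes on the real span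
    and then on the complex one. That span contains [z], where [g] does not vanish, so the
    restriction of [P] must be zero. *)
Lemma vanish_on_span (P g : ip C n.+1) k z : F = P ^+ k * g -> ev z P = 0 -> ev z g != 0 ->
  ev z F = 0 ->
  forall a b, ev (fun i => a * 'Re (z i) + b * 'Im (z i)) P = 0.
Proof.
move=> FE Pz gz Fz a b.
pose plane := sub (ipC C 2) (fun i => ipC C 2 ('Re (z i)) * ipvar C ord0 + ipC C 2 ('Im (z i)) * ipvar C ord_max).
have pE q s : ev s (plane q) = ev (fun i => s ord0 * 'Re (z i) + s ord_max * 'Im (z i)) q.
  rewrite ev_sub; apply: eq_ev => i; rewrite rmorphD !rmorphM !ev_C !ev_var.
  by rewrite mulrC [_ * s ord_max]mulrC.
have F0 : plane F = 0.
  apply: ev_real_eq0 => s rs; rewrite pE.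
  have : ev (fun i => 'Im ((s ord_max + 'i * s ord0) * z i)) F = 0.
    by apply: HF; rewrite hom Fz mulr0.
  move=> <-; apply: eq_ev => i; rewrite {3}[z i]Crect.
  have -> : (s ord_max + 'i * s ord0) * ('Re (z i) + 'i * 'Im (z i)) =
     (s ord_max * 'Re (z i) + 'i ^+ 2 * (s ord0 * 'Im (z i))) +
     'i * (s ord0 * 'Re (z i) + s ord_max * 'Im (z i)) by ring.
  by rewrite sqrCi Im_rect // ?rpredD ?rpredM ?rpredN1 ?Creal_Re ?Creal_Im.
pose pt (u v : C) : 'I_2 -> C := fun i => if i == ord0 then u else v.
have g0 : plane g != 0.
  apply/eqP => g0; case/eqP: gz; have := pE g (pt 1 'i); rewrite g0 rmorph0 => ->.
  by apply: eq_ev => i; rewrite /pt /= mul1r -Crect.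
have : plane P = 0.
  move: F0; rewrite FE rmorphM rmorphXn => /eqP; rewrite mulf_eq0 (negPf g0) orbF expf_eq0.
  by case/andP=> _ /eqP.
by move/(congr1 (ev (pt a b))); rewrite pE rmorph0 /pt.
Qed.

(** A non-unit factor free of variable 0 has a zero [w], and [F] would vanish on the whole line over
    [w] parallel to the first axis. *)
Lemma factor_size_gt1 (P : {poly ip C n}) : P \isn't a GRing.unit -> divides P F -> (1 < size P)%N.
Proof.
move=> nu [K FE]; rewrite ltnNge; apply/negP => s1; have PE := size1_polyC s1.
have [w cw] : exists w, ev w P`_0 = 0.
  apply: NNPP => H; case/negP: nu; rewrite PE; apply: rmorph_unit; apply: ev_neq0_unit => w.
  by apply/eqP => cw; apply: H; exists w.
apply: (line_nonconst (x := pcons 0 w) (c := 0) hom _ Fe) => [|t]; first by right.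
have -> : ev (fun i => pcons 0 w i + t * pcons 1 (fun=> 0) i) F = ev (pcons t w) F.
  apply: eq_ev => i; rewrite /pcons; case: unlift => [j|]; first by rewrite mulr0 addr0.
  by rewrite add0r mulr1.
by rewrite FE (rmorphM (ev _)) /= [X in _ * X]ev_pcons PE map_polyC hornerC /= cw mulr0.
Qed.

Lemma prime_factor_root (P : {poly ip C n}) : prime_elt P -> divides P F ->
  exists (l : 'I_n -> C) (k : C), P.[ipC C n k + \sum_(j < n) ipC C n (l j) * ipvar C j] = 0.
Proof.
move=> pP dP; have sP : (1 < size P)%N by case: pP => _ nu _; apply: factor_size_gt1.
have [P0 _ primeP] := pP.
have F0 : F != 0 by apply: contraNneq Fe => ->; rewrite rmorph0.
have [k [g [FE ndg]]] := max_power sP F0.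
have nd : ~ divides P (P^`() * g) by case/primeP => //; apply: not_divides_deriv.
have [c [u [v [c0 cE]]]] := elimination pP sP nd.
(* Where [c2] is nonzero, [P] has a root in variable 0, and at every such root neither the
   derivative of [P] nor [g] vanishes. *)
pose c2 := c * lead_coef P.
have c20 : c2 != 0 by rewrite mulf_neq0 ?lead_coef_eq0.
have [y ry c2y] := ev_real_neq0 c20.
have root_of w : ev w c2 != 0 -> (1 < size (map_poly (ev w) P))%N.
  by rewrite rmorphM mulf_eq0 => /norP[_ lw]; rewrite size_map_poly_id0.
have Py0 : map_poly (ev y) P != 0 by rewrite -size_poly_gt0 ltnW // root_of.
have [rs rsP] := poly_rootsP Py0.
pose D r j := dir_deriv (P : ip C n.+1) (pcons r y) (unitv C (lift ord0 j)).
(* Slopes of the tangent hyperplane at [(r, y)]: a vector killed by the gradient has first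
   coordinate [\sum_j l r j * x j]. *)
pose l r j := - (D r j / ev (pcons r y) (P^`() : ip C n.+1)).
pose ell r : ip C n := \sum_(j < n) ipC C n (l r j) * ipvar C j.
have ellE r x : ev x (ell r) = \sum_(j < n) l r j * x j.
  by rewrite rmorph_sum; apply: eq_bigr => j _; rewrite rmorphM ev_C ev_var.
(* [N r] tests the guess that [\sum_j l r j * x j + 'i r] is a root of [P] over [x + 'i y]. *)
pose N r : ip C n := sub (ipC C n) (fun i => if unlift ord0 i is Some j
   then ipvar C j + ipC C n ('i * y j) else ell r + ipC C n ('i * r)) (P : ip C n.+1).
have NE r x : ev x (N r) =
    ev (pcons (\sum_(j < n) l r j * x j + 'i * r) (fun j => x j + 'i * y j)) (P : ip C n.+1).
  rewrite ev_sub; apply: eq_ev => i; rewrite /pcons; case: unlift => [j|].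
    by rewrite rmorphD ev_var ev_C.
  by rewrite rmorphD ellE ev_C.
pose C2 : ip C n := sub (ipC C n) (fun j => ipvar C j + ipC C n ('i * y j)) c2.
have C2E x : ev x C2 = ev (fun j => x j + 'i * y j) c2.
  by rewrite ev_sub; apply: eq_ev => i; rewrite rmorphD ev_var ev_C.
have C20 : C2 != 0.
  apply/eqP => C20; have := C2E (fun j => y j - 'i * y j); rewrite C20 rmorph0.
  rewrite (@eq_ev _ _ _ y) => [/esym/eqP|j]; first by rewrite (negPf c2y).
  by rewrite subrK.
(* Take any root [t] over [x + 'i y]. By [vanish_on_span], ['Im t] is a root over [y], and [P]
   vanishes along the line through the imaginary part in the direction of the real part; so the
   gradient determines ['Re t]. *)
have key x : realvec x -> ev x C2 != 0 -> exists2 r, r \in rs & ev x (N r) = 0.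
  move=> rx; rewrite C2E => c2x; pose W j := x j + 'i * y j.
  have /closed_rootP[t /rootP] : (size (map_poly (ev W) P) != 1)%N.
    by rewrite neq_ltn root_of ?orbT.
  rewrite -ev_pcons; set z := pcons t W => Pz.
  have cz q : ev q (c%:P : ip C n.+1) = ev (fun j => q (lift ord0 j)) c.
    by rewrite -(eq_ev _ (pcons_eta q)) ev_pcons map_polyC hornerC.
  have cP q : ev q (P : ip C n.+1) = 0 -> ev (fun j => q (lift ord0 j)) c != 0 ->
      ev q (P^`() : ip C n.+1) != 0 /\ ev q (g : ip C n.+1) != 0.
    move=> Pq; rewrite -cz cE (rmorphD (ev _)) !(rmorphM (ev _)) Pq mulr0 add0r.
    by rewrite !mulf_eq0 !negb_or => /and3P[_ -> ->].
  have [|_ gz] := cP z Pz.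
    rewrite (@eq_ev _ _ _ W) => [|j]; last by rewrite /z pconsS.
    by move: c2x; rewrite rmorphM mulf_eq0 => /norP[].
  have Fz : ev z F = 0.
    by case: dP => K ->; rewrite (rmorphM (ev _)) Pz mulr0.
  have span := vanish_on_span FE Pz gz Fz.
  pose r := 'Im t; pose Y := pcons r y; pose X := pcons ('Re t) x.
  have ReE i : 'Re (z i) = X i.
    by rewrite /z /X /pcons; case: unlift => // j; rewrite /W Re_rect.
  have ImE i : 'Im (z i) = Y i.
    by rewrite /z /Y /pcons; case: unlift => // j; rewrite /W Im_rect.
  have PY : ev Y (P : ip C n.+1) = 0.
    rewrite -(span 0 1); apply: eq_ev => i; by rewrite mul0r add0r mul1r ImE.
  have [|dY _] := cP Y PY.
    rewrite (@eq_ev _ _ _ y) => [|j]; last by rewrite /Y pconsS.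
    by move: c2y; rewrite rmorphM mulf_eq0 => /norP[].
  have DX : dir_deriv (P : ip C n.+1) Y X = 0.
    rewrite /dir_deriv; have -> : line_poly (P : ip C n.+1) Y X = 0.
      apply: poly_real_roots_eq0 => s _; rewrite line_polyE -(span s 1).
      by apply: eq_ev => i; rewrite mul1r ReE ImE addrC.
    by rewrite deriv0 horner0.
  exists r; first by apply: rsP; apply/rootP; rewrite -ev_pcons.
  rewrite NE -[RHS]Pz; apply: eq_ev => i; rewrite /z /pcons; case: unlift => //.
  rewrite [t in RHS]Crect -/r; congr (_ + _).
  move: DX; rewrite dir_deriv_linear big_ord_recl /X /Y dir_deriv0 pcons0.
  rewrite (eq_bigr (fun j => x j * D r j)) => [|j _]; last by rewrite pconsS.
  rewrite addrC => /eqP; rewrite addr_eq0 => /eqP E.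
  apply: (mulIf dY); rewrite /Y mulr_suml -[RHS]opprK -E -sumrN.
  apply: eq_bigr => j _; rewrite /l; set q := ev _ _.
  have -> : - (D r j / q) * x j * q = - (x j * (D r j / q * q)) by ring.
  by rewrite divfK.
(* Finitely many guesses cover all real [x] off the zeros of [C2], so one of them holds
   identically. *)
have : (\prod_(r <- rs) N r) * C2 = 0.
  apply: ev_real_eq0 => x rx; rewrite rmorphM.
  have [->|/(key x rx)[r rrs Nr]] := eqVneq (ev x C2) 0; first by rewrite mulr0.
  by rewrite rmorph_prod (big_rem r) //= Nr !mul0r.
move=> /eqP; rewrite mulf_eq0 (negPf C20) orbF prodf_seq_eq0 => /hasP[r _ /eqP Nr].
(* Substituting [x = w - 'i y] undoes the shift and produces the constant term. *)
exists (l r), ('i * r - \sum_(j < n) l r j * ('i * y j)).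
apply: ev_inj => w; rewrite rmorph0.
rewrite -horner_map rmorphD ev_C -/(ell r) ellE -ev_pcons.
have := NE r (fun j => w j - 'i * y j); rewrite Nr rmorph0 => NE0; rewrite [RHS]NE0.
apply: eq_ev => i; rewrite /pcons; case: unlift => [j|]; first by rewrite subrK.
rewrite [in RHS](eq_bigr (fun j => l r j * w j - l r j * ('i * y j))) => [|j _]; last by rewrite mulrBr.
by rewrite sumrB; ring.
Qed.

(** [P] is a unit times ['X - M]. At a real [w] the zero [(M(w), w)] has imaginary part ['Im (M(w))]
    times the first unit vector, where [F] is nonzero; so [M] is real at real points, and the origin
    and unit vectors give real coefficients. *)
Lemma prime_factor_real_linear (P : {poly ip C n}) : prime_elt P -> divides P F ->
  exists c l, real_linear l /\ forall z, ev z (P : ip C n.+1) = c * meval l z.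
Proof.
move=> pP dP; have [l [k Pr]] := prime_factor_root pP dP.
set M := ipC C n k + _ in Pr.
have ME w : ev w M = k + \sum_(j < n) l j * w j.
  rewrite rmorphD ev_C rmorph_sum; congr (_ + _).
  by apply: eq_bigr => j _; rewrite rmorphM ev_C ev_var.
have [Q PE] := factor_theorem P M (introT rootP Pr).
have [P0 _ primeP] := pP.
have uQ : Q \is a GRing.unit.
  have [|[q E]|[q E]] := primeP Q ('X - M%:P); first by exists 1; rewrite mul1r PE.
    have Q0 : Q != 0 by apply: contraNneq P0 => Q0; rewrite PE Q0 mul0r.
    have : ('X - M%:P) \is a GRing.unit.
      apply/unitrPr; exists q; apply: (mulfI Q0); rewrite mulr1 {2}E PE; ring.
    by rewrite poly_unitE size_XsubC.
  apply/unitrPr; exists q; apply: (mulIf (negbT (polyXsubC_eq0 M))).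
  by rewrite mul1r [RHS]E PE; ring.
have [c QE] := unit_ipC (uQ : (Q : ip C n.+1) \is a GRing.unit).
have Mr w : realvec w -> ev w M \is Num.real.
  move=> rw; have Pz : ev (pcons (ev w M) w) (P : ip C n.+1) = 0.
    by rewrite ev_pcons horner_map Pr rmorph0.
  have Fz : ev (pcons (ev w M) w) F = 0 by case: dP => K ->; rewrite (rmorphM (ev _)) Pz mulr0.
  have := HF Fz.
  rewrite (@eq_ev _ _ _ (fun i => 'Im (ev w M) * pcons 1 (fun=> 0) i)) => [|i].
    rewrite hom => /eqP; rewrite mulf_eq0 (negPf Fe) orbF expf_eq0 => /andP[_ /eqP Im0].
    by rewrite [ev w M]Crect Im0 mulr0 addr0 Creal_Re.
  rewrite /pcons; case: unlift => [j|]; last by rewrite mulr1.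
  by rewrite mulr0; apply/Creal_ImP/rw.
have kr : k \is Num.real.
  have := Mr (fun=> 0); rewrite ME big1 ?addr0 => [|j _]; last by rewrite mulr0.
  by apply=> i; rewrite real0.
have lr j : l j \is Num.real.
  have := Mr (unitv C j); rewrite ME (bigD1 j) //= /unitv eqxx mulr1 big1 => [|i ij].
    rewrite addr0 => H; rewrite -[l j](addKr k) rpredD ?rpredN //.
    by apply: H => i; rewrite realn.
  by rewrite (negPf ij) mulr0.
exists c, (linpoly (- k) (pcons 1 (fun j => - l j))); split.
  exists (- k), (pcons 1 (fun j => - l j)); split; first by rewrite rpredN.
  by split=> // i; rewrite /pcons; case: unlift => [j|]; rewrite ?rpredN ?lr ?real1.
move=> z; rewrite meval_linpoly PE (rmorphM (ev _)) QE ev_C; congr (_ * _).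
rewrite -(eq_ev _ (pcons_eta z)) ev_pcons map_polyXsubC hornerXsubC ME.
rewrite big_ord_recl pcons0 mul1r.
rewrite [in RHS](eq_bigr (fun j => - (l j * z (lift ord0 j)))) => [|j _].
  by rewrite sumrN; ring.
by rewrite pconsS mulNr.
Qed.

Lemma real_split_F : real_split F.
Proof.
have F0 : F != 0 by apply: contraNneq Fe => ->; rewrite rmorph0.
suff H G : factored G -> divides G F -> real_split G.
  by apply: H; [apply: ufd_ip|exists 1; rewrite mul1r].
elim=> {G} [u uu _|P G pP _ IH dPG].
  have [c uE] := unit_ipC uu; exists c, [::]; split=> // z.
  by rewrite uE ev_C big_nil mulr1.
have [|c [ls [lsr GE]]] := IH.
  by apply: divides_trans dPG; exists P.
have [|k [l [lr PE]]] := @prime_factor_real_linear P pP.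
  by apply: divides_trans dPG; exists G; rewrite mulrC.
exists (k * c), (l :: ls); split=> [h|z].
  by rewrite inE => /orP[/eqP->|/lsr].
by rewrite rmorphM GE PE big_cons mulrACA.
Qed.

End RealSplit.

(** * Undoing the shear, and the equality case *)

Lemma real_linear_shear (C : numClosedFieldType) n (a : 'I_n -> C) (l : mpoly C n.+1) :
  realvec a -> real_linear l ->
  exists2 l', real_linear l' & forall z, meval l' z = meval l (shear a z).
Proof.
move=> ra [b0 [b [rb0 [rb ->]]]].
pose b' := pcons (b ord0 + \sum_(j < n) b (lift ord0 j) * a j) (fun j => b (lift ord0 j)).
exists (linpoly b0 b').
  exists b0, b'; split=> //; split=> // i; rewrite /b' /pcons; case: unlift => [j|] //.
  by rewrite rpredD // rpred_sum // => j _; rewrite rpredM.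
move=> z; rewrite !meval_linpoly !big_ord_recl /b' /shear !pcons0; congr (_ + _).
rewrite mulrDl -addrA; congr (_ + _); rewrite mulr_suml -big_split.
by apply: eq_bigr => j _ /=; rewrite !pconsS; ring.
Qed.

Lemma real_linear_shear_seq (C : numClosedFieldType) n (a : 'I_n -> C) (ls : seq (mpoly C n.+1)) :
  realvec a -> (forall l, l \in ls -> real_linear l) ->
  exists2 ls' : seq (mpoly C n.+1), (forall l, l \in ls' -> real_linear l) &
    forall z, \prod_(l <- ls') meval l z = \prod_(l <- ls) meval l (shear a z).
Proof.
move=> ra; elim: ls => [|l ls IH] H.
  by exists [::] => // z; rewrite !big_nil.
have [|ls' Hls' E'] := IH; first by move=> k kls; apply: H; rewrite inE kls orbT.
have [|l' Hl' E] := real_linear_shear (l := l) ra; first by apply: H; rewrite inE eqxx.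
exists (l' :: ls') => [k|z]; first by rewrite inE => /orP[/eqP->|/Hls'].
by rewrite !big_cons E E'.
Qed.

Lemma imag_proj_real_split (C : numClosedFieldType) n d (f : mpoly C n) :
  homog d (toip f) -> toip f != 0 ->
  (forall x, imag_proj f x -> real_zero_set f x) -> real_split (toip f).
Proof.
case: n f => [|n] f hom f0 H.
  exists (toip f), [::]; split=> // z; by rewrite big_nil mulr1.
(* The extra factor forces a nonzero first coordinate, so that [e] can be scaled to [pcons 1 a]. *)
have X0 : toip f * ipvar C ord0 != 0.
  rewrite mulf_neq0 //; apply/eqP => E; have := ev_var (fun=> 1 : C) (ord0 : 'I_n.+1).
  by rewrite E rmorph0 => /esym/eqP; rewrite oner_eq0.
have [e re] := ev_real_neq0 X0; rewrite rmorphM ev_var mulf_eq0 => /norP[fe e0].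
pose a j := (e ord0)^-1 * e (lift ord0 j).
have ra : realvec a by move=> j; rewrite rpredM ?rpredV.
have eE i : e i = e ord0 * pcons 1 a i.
  rewrite /pcons /a; case: (unliftP ord0 i) => [j|] ->; last by rewrite mulr1.
  by rewrite mulrA divff // mul1r.
have fa : ev (pcons 1 a) (toip f) != 0 by move: fe; rewrite (eq_ev _ eE) (homog_eq0 _ hom).
have [||z Fz|c [ls [lsr FE]]] := @real_split_F C n d (shear_ip a (toip f)).
- move=> l z; rewrite !ev_shear -hom; apply: eq_ev => i; rewrite /shear /pcons.
  by case: unlift => [j|] //; ring.
- rewrite ev_shear (eq_ev _ (shear_pcons _ _ _)) (@eq_ev _ _ _ (pcons 1 a)) // => i.
  by rewrite mul1r /pcons; case: unlift => [j|]; rewrite add0r.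
- rewrite ev_shear in Fz; rewrite ev_shear.
  have [_] : real_zero_set f (fun i => 'Im (shear a z i)).
    apply: H; split; first by move=> i; exact: Creal_Im.
    by exists (shear a z); rewrite -ev_toip.
  rewrite -ev_toip => E; rewrite -[RHS]E; apply: eq_ev => i; rewrite /shear /pcons.
  case: unlift => [j|] //; rewrite raddfD /=; congr (_ + _).
  by rewrite ImMr // ra.
have rna : realvec (fun j => - a j) by move=> j; rewrite rpredN.
have [ls' rls' E] := real_linear_shear_seq rna lsr.
exists c, ls'; split=> // z; by rewrite (ev_unshear a) FE E.
Qed.

(** Some linear factor vanishes on the whole complex line through a zero [z]; hence its constant
    term is 0, and having real coefficients it vanishes at the imaginary part too. *)
Lemma real_split_imag_proj (C : numClosedFieldType) n d (f : mpoly C n) u (ls : seq (mpoly C n)) :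
  homog d (toip f) -> u != 0 -> (forall l, l \in ls -> real_linear l) ->
  mpeq (mpscale u f) (mpprod ls) -> forall x, imag_proj f x -> real_zero_set f x.
Proof.
move=> hom u0 lsr /mpeqP E x [rx [z [fz xE]]]; split=> //.
have fE w : u * meval f w = \prod_(l <- ls) meval l w.
  have := congr1 (ev w) E; rewrite toip_scale toip_prod rmorphM ev_C rmorph_prod ev_toip => ->.
  by apply: eq_bigr => l _; rewrite ev_toip.
(* Working with polynomials in [t] selects one factor that vanishes for all [t] at once. *)
have : \prod_(l <- ls) line_poly (toip l) (fun=> 0) z = 0.
  apply: poly_real_roots_eq0 => t _; rewrite horner_prod.
  rewrite (eq_bigr (fun l => meval l (fun i => 0 + t * z i))) => [|l _].
    rewrite -fE -ev_toip (@eq_ev _ _ _ (fun i => t * z i)) ?hom ?ev_toip ?fz ?mulr0 // => i.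
    by rewrite add0r.
  by rewrite line_polyE ev_toip.
move=> /eqP; rewrite prodf_seq_eq0 => /hasP[l lls /= /eqP L0].
suff lx : meval l x = 0.
  by apply: (mulfI u0); rewrite fE mulr0 (big_rem l) //= lx mul0r.
have [a0 [a [ra0 [ra lE]]]] := lsr l lls.
have H t : a0 + t * (\sum_(i < n) a i * z i) = 0.
  have := line_polyE (toip l) (fun=> 0) z t; rewrite L0 horner0 ev_toip lE meval_linpoly.
  move=> E0; rewrite [RHS]E0 mulr_sumr; congr (_ + _); apply: eq_bigr => i _; ring.
have a00 : a0 = 0 by have := H 0; rewrite mul0r addr0.
have az : \sum_(i < n) a i * z i = 0 by have := H 1; rewrite a00 add0r mul1r.
rewrite lE meval_linpoly a00 add0r.
have Im0 : 'Im (\sum_(i < n) a i * z i) = 0 by rewrite az raddf0.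
by rewrite -[RHS]Im0 raddf_sum; apply: eq_bigr => i _; rewrite xE /= ImMl.
Qed.

Theorem theorem3p5 (C : numClosedFieldType) (n : nat) (f : mpoly C n) :
  mp_nonzero f -> mp_homogeneous f ->
  ((forall x, real_zero_set f x -> imag_proj f x) /\
   ((forall x, real_zero_set f x <-> imag_proj f x) <->
    exists u : C, `|u| = 1 /\
      exists ls : seq (mpoly C n),
        (forall l, l \in ls -> real_linear l) /\
        mpeq (mpscale u f) (mpprod ls)))
  /\
  (hyperbolic f -> mp_irreducible f ->
   forall z, zariski_closure (rboundary (rcompl (imag_proj f))) z
             <-> zero_set f z).
Proof.
move=> nz [d hd]; have f0 : toip f != 0 by apply/toip_nonzero.
have hom : homog d (toip f) by move=> l w; rewrite !ev_toip (meval_homogeneous hd).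
split; last exact: zariski_boundary.
have incl x : real_zero_set f x -> imag_proj f x by apply: real_zero_imag_proj hom _.
split=> //; split=> [H|[u [u1 [ls [rls E]]]] x]; last first.
  split; first exact: incl.
  have u0 : u != 0 by rewrite -normr_gt0 u1 ltr01.
  exact: real_split_imag_proj hom u0 rls E x.
have [c [ls [rls fE]]] : real_split (toip f).
  by apply: imag_proj_real_split hom f0 _ => x /H.
have c0 : c != 0.
  by apply: contraNneq f0 => c0; apply/eqP/ev_inj => z; rewrite fE c0 mul0r rmorph0.
(* A scalar of modulus 1 removes only the phase of [c]; its modulus enters the list as a constant
   linear polynomial. *)
exists (`|c| / c); split; first by rewrite normrM normfV normr_id divff ?normr_eq0.
exists (linpoly `|c| (fun=> 0) :: ls); split=> [l|].
  rewrite inE => /orP[/eqP->|/rls//]; exists `|c|, (fun=> 0); split; first exact: normr_real.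
  by split=> // i; rewrite real0.
apply/mpeqP; rewrite toip_scale toip_prod; apply: ev_inj => z.
rewrite rmorphM ev_C fE rmorph_prod big_cons ev_toip meval_linpoly mulrA divfK //.
have -> : \sum_(i < n) 0 * z i = 0 by apply: big1 => i _; rewrite mul0r.
by rewrite addr0; congr (_ * _); apply: eq_bigr => l _; rewrite ev_toip.
Qed.
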